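(* Let $X$, $Y$ be separable real Hilbert spaces, $A\colon X\to Y$ a bounded linear operator, $x$ a square-integrable $X$-valued random variable with mean $\mu$ and injective covariance $\Sigma_x$, and $\varepsilon$ a zero-mean linear random process on $Y$ with bounded injective covariance $\Sigma_\varepsilon$, independent of $x$. Let $K$ be a separable real Hilbert space and $\iota\colon K\to Y$ a bounded injective linear map with dense range such that $\iota^*\Sigma_\varepsilon\iota\colon K\to K^*$ is trace-class; regard $\varepsilon$ as a $K^*$-valued random vector and let $y=\iota^*Ax+\varepsilon$. Assume: (i) $x$ is $\kappa$-sub-Gaussian, i.e. for every $v\in X$ and every $p>1$, $\|\langle x,v\rangle_X\|_p\le\kappa\sqrt p\,\|\langle x,v\rangle_X\|_2$, where $\|\langle x,v\rangle_X\|_p^p=\mathbb{E}[|\langle x,v\rangle_X|^p]$; (ii) $\Sigma_\varepsilon$ has a bounded inverse (thus $\Sigma_\varepsilon+A\Sigma_xA^*$ is invertible); (iii) the operator $A^*(\iota^*(\Sigma_\varepsilon+A\Sigma_xA^* ))^{-1}$, defined on $\iota^*(Y)\subseteq K^*$, extends to a bounded operator from $K^*$ into $X$. Let $x_1,\dots,x_m$ be i.i.d. copies of $x$ and set $$\widehat h_U=\widehat\mu=\frac1m\sum_{i=1}^mx_i,\qquad \widehat B_U=\widehat{\Sigma}_x^{1/2},\qquad \widehat{\Sigma}_x=\frac1m\sum_{i=1}^m(x_i-\widehat\mu)\otimes(x_i-\widehat\mu),$$ and $(h^\star,B^\star)=(\mu,\Sigma_x^{1/2})$. Take $\tau>0$.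 Then, with probability exceeding $1-e^{-\tau}$, $$|L(\widehat h_U,\widehat B_U)-L(h^\star,B^\star)|\le\frac{c_3+c_4\sqrt\tau}{\sqrt m},\qquad m\ge m_0,$$ where $m_0$, $c_3$ and $c_4$ depend only on $\Sigma_x$, $\Sigma_\varepsilon$ and $A$.
   Context: Conventions: $X$ and $Y$ are identified with their duals, but $K$ is not; thus $A^*\colon Y\to X$, $\iota^*\colon Y\to K^*$. ''Positive'' means self-adjoint and non-negative. $u\otimes u$ is the operator $v\mapsto\langle v,u\rangle_Xu$. A zero-mean linear random process on $Y$ with covariance $\Sigma_\varepsilon$ is a family $(\varepsilon_v)_{v\in Y}$ of real random variables, linear in $v$, with $\mathbb{E}[\varepsilon_v]=0$ and $\mathbb{E}[\varepsilon_v\varepsilon_w]=\langle\Sigma_\varepsilon v,w\rangle_Y$. Since $\iota^*\Sigma_\varepsilon\iota$ is trace-class, there is a unique square-integrable zero-mean $K^*$-valued random vector, still denoted $\varepsilon$, with $\langle\varepsilon,v\rangle_{K^*\times K}=\varepsilon_{\iota(v)}$ a.s. for each $v\in K$. For $h\in X$ and $B\colon X\to X$ bounded and positive, the reconstruction map is $$R_{h,B}(y)=h+W_B(y-\iota^*Ah),\qquad y\in K^*,\qquad W_B=B^2A^*\big(\iota^*(AB^2A^*+\Sigma_\varepsilon)\big)^{-1},$$ where $W_B$, a priori defined on a dense subspace of $K^*$, denotes its bounded extension $K^*\to X$. (It coincides with $B(BA^*\Sigma_\varepsilon^{-1}AB+I)^{-1}((\Sigma_\varepsilon\iota)^{-1}AB)^*$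 when $\operatorname{Im}(AB)\subseteq\operatorname{Im}(\Sigma_\varepsilon\iota)$.) The expected error is $L(h,B)=\mathbb{E}_{x,y}\|R_{h,B}(y)-x\|_X^2$; $L(\widehat h_U,\widehat B_U)$ is $L$ evaluated at the sample-dependent pair, the expectation being over $(x,y)$ independent of the sample.
   Formalization: The constants c_3, c_4 may depend on κ and μ as well as on Σ_x, Σ_ε and A, and m_0 may additionally depend on τ; with constants depending only on Σ_x, Σ_ε and A the claim is false already for X=Y=ℝ. *)

(* Defs.v *)
From HB Require Import structures.
From mathcomp Require Import all_boot all_order all_algebra.
From mathcomp Require Import all_classical all_reals all_analysis.
From mathcomp Require Import ring.

Set Implicit Arguments.
Unset Strict Implicit.
Unset Printing Implicit Defensive.

Import Order.TTheory GRing.Theory Num.Theory.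
Import numFieldNormedType.Exports.

Local Open Scope classical_set_scope.
Local Open Scope ereal_scope.
Local Open Scope ring_scope.

HB.mixin Record CompleteNormedModule_isHilbert (R : realType) X
    & CompleteNormedModule R X := {
  inner : X -> X -> R ;
  innerC : forall u v, inner u v = inner v u ;
  inner_linearl : forall (a : R) u v w,
    inner (a *: u + v) w = a * inner u w + inner v w ;
  inner_norm : forall u, inner u u = `|u| ^+ 2
}.

#[short(type="hilbertType")]
HB.structure Definition Hilbert (R : realType) :=
  {X of CompleteNormedModule R X & CompleteNormedModule_isHilbert R X}.

Section inner_theory.
Context {R : realType} {X : hilbertType R}.
Implicit Types u v w : X.

Lemma innerDl u v w : inner (u + v) w = inner u w + inner v w.
Proof. by have := inner_linearl 1 u v w; rewrite scale1r mul1r. Qed.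

Lemma inner0l w : inner 0 w = 0.
Proof. by apply: (addrI (inner 0 w)); rewrite -innerDl !addr0. Qed.

Lemma innerZl (a : R) u w : inner (a *: u) w = a * inner u w.
Proof. by have := inner_linearl a u 0 w; rewrite addr0 inner0l addr0. Qed.

Lemma innerDr u v w : inner w (u + v) = inner w u + inner w v.
Proof. by rewrite ![inner w _]innerC innerDl. Qed.

Lemma innerZr (a : R) u w : inner w (a *: u) = a * inner w u.
Proof. by rewrite ![inner w _]innerC innerZl. Qed.

Lemma Cauchy_Schwarz u v : `|inner u v| <= `|u| * `|v|.
Proof.
have [->|v0] := eqVneq v 0; first by rewrite innerC inner0l !normr0 mulr0.
have v2 : 0 < `|v| ^+ 2 by rewrite exprn_gt0// normr_gt0.
rewrite -(@ler_pXn2r _ 2)// ?nnegrE ?mulr_ge0// real_normK ?num_real// exprMn.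
rewrite -subr_ge0 -(pmulr_rge0 _ v2).
have <- : inner (`|v| ^+ 2 *: u + (- inner u v) *: v)
               (`|v| ^+ 2 *: u + (- inner u v) *: v)
    = `|v| ^+ 2 * (`|u| ^+ 2 * `|v| ^+ 2 - inner u v ^+ 2).
  by rewrite !(innerDl, innerDr, innerZl, innerZr) !inner_norm (innerC v u); ring.
by rewrite inner_norm exprn_ge0.
Qed.

End inner_theory.

Section dual.
Context {R : realType} {K : normedModType R}.

Definition is_functional : {pred K -> R^o} :=
  fun f => `[< linear f /\ continuous f >].

Lemma is_functional_submod : submod_closed is_functional.
Proof.
split; first by apply/asboolP; split=> [a u v|v] /=;
  [rewrite scaler0 addr0|exact: cvg_cst].
move=> a f g /asboolP[lf cf] /asboolP[lg cg]; apply/asboolP; split.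
  move=> b u v; rewrite /= !fctE lf lg !scalerDr !scalerA (mulrC a b).
  by rewrite addrACA.
move=> v; apply: (@continuousD _ _ _ (a *: f) g); last exact: cg.
by apply: (@continuousZr _ _ _ f a); exact: cf.
Qed.
HB.instance Definition _ :=
  GRing.isSubmodClosed.Build R (K -> R^o) is_functional is_functional_submod.

End dual.
Arguments is_functional {R} K.

(* the topological dual of K *)
Record dual {R : realType} (K : normedModType R) := Dual {
  dual_fun :> K -> R^o ;
  dual_funP : dual_fun \in is_functional K }.

HB.instance Definition _ (R : realType) (K : normedModType R) :=
  [isSub for @dual_fun R K].
HB.instance Definition _ (R : realType) (K : normedModType R) :=
  [Choice of dual K by <:].
HB.instance Definition _ (R : realType) (K : normedModType R) :=
  [SubChoice_isSubLmodule of dual K by <:].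

Section dual_norm.
Context {R : realType} {K : normedModType R}.
Implicit Types phi psi : dual K.

Lemma dual_linear phi : linear phi.
Proof. by have /asboolP[] := dual_funP phi. Qed.

Lemma dual_continuous phi : continuous phi.
Proof. by have /asboolP[] := dual_funP phi. Qed.

Definition dual_norm phi : R := sup [set `|phi v| | v in [set v | `|v| <= 1]].

Lemma dualD phi psi v : (phi + psi) v = phi v + psi v.
Proof. by []. Qed.

Lemma dualZ (a : R) phi v : (a *: phi) v = a * phi v.
Proof. by []. Qed.

Lemma dual_eq phi psi : (forall v, phi v = psi v) -> phi = psi.
Proof. by move=> h; apply: val_inj; apply/funext => v; exact: h. Qed.

Lemma dual_homog phi (a : R) v : phi (a *: v) = a * phi v.
Proof.
have phi0 : phi 0 = 0.
  have := dual_linear phi 1 0 0; rewrite !scale1r addr0 => /esym/eqP.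
  by rewrite -subr_eq0 addrK => /eqP.
by have := dual_linear phi a v 0; rewrite !addr0 phi0 addr0.
Qed.

Lemma dual_has_sup phi : has_sup [set `|phi v| | v in [set v | `|v| <= 1]].
Proof.
split; first by exists `|phi 0|, 0 => //=; rewrite normr0.
pose f : {linear K -> R^o} :=
  HB.pack (dual_fun phi) (GRing.isLinear.Build R K R^o _ _ (dual_linear phi)).
have /linear_boundedP : bounded_near f (nbhs (0 : K)).
  by apply/linear_bounded_continuous; exact: dual_continuous.
move=> /pinfty_ex_gt0[r r0 fr]; exists r => _ [v /= v1 <-].
by apply: le_trans (fr v) _; rewrite ger_pMr.
Qed.

Lemma dual_norm_ub phi v : `|v| <= 1 -> `|phi v| <= dual_norm phi.
Proof. by move=> v1; apply: sup_upper_bound; [exact: dual_has_sup|exists v]. Qed.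

Lemma dual_norm_ge0 phi : 0 <= dual_norm phi.
Proof. by apply: le_trans (dual_norm_ub phi (v := 0) _); rewrite ?normr0. Qed.

Lemma dual_norm_le phi M :
  (forall v, `|v| <= 1 -> `|phi v| <= M) -> dual_norm phi <= M.
Proof.
move=> h; apply: ge_sup; first by have [] := dual_has_sup phi.
by move=> _ [v v1 <-]; exact: h.
Qed.

Lemma dual_normP phi v : `|phi v| <= dual_norm phi * `|v|.
Proof.
have [->|v0] := eqVneq v 0.
  by rewrite -[0 as X in phi X](scale0r 0) dual_homog mul0r !normr0 mulr0.
have nv : 0 < `|v| by rewrite normr_gt0.
rewrite -ler_pdivrMr// mulrC -[_^-1]gtr0_norm ?invr_gt0// -normrM -dual_homog.
by apply: dual_norm_ub; rewrite normrZ gtr0_norm ?invr_gt0// mulVf ?gt_eqF.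
Qed.

Lemma ler_dual_normD phi psi :
  dual_norm (phi + psi) <= dual_norm phi + dual_norm psi.
Proof.
apply: dual_norm_le => v v1; rewrite dualD (le_trans (ler_normD _ _))//.
by rewrite lerD ?dual_norm_ub.
Qed.

Lemma dual_normZ (a : R) phi : dual_norm (a *: phi) = `|a| * dual_norm phi.
Proof.
have le b f : dual_norm (b *: f) <= `|b| * dual_norm f.
  apply: dual_norm_le => v v1; rewrite dualZ normrM.
  by rewrite ler_wpM2l ?dual_norm_ub.
apply/eqP; rewrite eq_le le/=.
have [->|a0] := eqVneq a 0; first by rewrite normr0 mul0r dual_norm_ge0.
rewrite -ler_pdivlMl ?normr_gt0// -normfV.
by apply: le_trans (le _ _); rewrite scalerA mulVf// scale1r.
Qed.

Lemma dual_norm0_eq0 phi : dual_norm phi = 0 -> phi = 0.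
Proof.
move=> n0; apply: dual_eq => v; apply/eqP; rewrite -normr_le0.
by apply: le_trans (dual_normP _ _) _; rewrite n0 mul0r.
Qed.

HB.instance Definition _ :=
  Lmodule_isNormed.Build R (dual K) ler_dual_normD dual_normZ dual_norm0_eq0.

End dual_norm.

Section operators.
Context {R : realType}.

(* [A^* y] is the Riesz representative of [x |-> <A x, y>] *)
Definition adjoint {X Y : hilbertType R} (A : X -> Y) (y : Y) : X :=
  get [set z | forall x, inner (A x) y = inner x z].

(* [iota^* : Y -> K^*], where [K] is not identified with its dual [K^*]; the
   default value 0 is used only if [iota] is not a bounded linear map *)
Definition dual_adjoint {K : normedModType R} {Y : hilbertType R}
    (iota : K -> Y) (y : Y) : dual K :=
  insubd 0 (fun v => inner y (iota v) : R^o).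

Lemma dual_adjointE (K : normedModType R) (Y : hilbertType R)
    (iota : {linear K -> Y}) (y : Y) (v : K) :
  continuous iota -> dual_adjoint iota y v = inner y (iota v).
Proof.
move=> ci; rewrite /dual_adjoint -[dual_fun _]/(val _) val_insubd ifT//.
pose f u : R^o := inner y (iota u).
have lf : linear f by move=> a u w; rewrite /f linearP innerDr innerZr.
pose g : {linear K -> R^o} := HB.pack f (GRing.isLinear.Build R K R^o _ _ lf).
apply/asboolP; split; first exact: lf.
apply: (bounded_linear_continuous (f := g)); apply/linear_boundedP.
have /linear_boundedP/pinfty_ex_gt0[r r0 ir] : bounded_near iota (nbhs (0 : K)).
  exact/linear_bounded_continuous.
near=> M => u; apply: le_trans (Cauchy_Schwarz _ _) _.
apply: (@le_trans _ _ (`|y| * r * `|u|)); first by rewrite -mulrA ler_wpM2l.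
by apply: ler_wpM2r => //; near: M; exact: nbhs_pinfty_ge.
Unshelve. all: by end_near. Qed.

Definition positive_op {X : hilbertType R} (B : X -> X) :=
  [/\ linear B, continuous B, (forall u v, inner (B u) v = inner u (B v)) &
      forall u, 0 <= inner (B u) u].

Definition is_sqrt {X : hilbertType R} (S B : X -> X) :=
  positive_op B /\ forall v, B (B v) = S v.

Definition bounded_inverse {Y : normedModType R} (S T : Y -> Y) :=
  [/\ linear T, continuous T, cancel S T & cancel T S].

(* [W] is a bounded operator extending [G F^-1], which is defined on the range
   of the injective operator [F] *)
Definition bounded_extension {U : Type} {V X : normedModType R}
    (F : U -> V) (G : U -> X) (W : V -> X) :=
  [/\ linear W, continuous W & forall u, W (F u) = G u].

(* nuclear operator; between Hilbert spaces this is the trace class, and it does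
   not require identifying a Hilbert space with its dual *)
Definition trace_class {E F : normedModType R} (T : E -> F) :=
  exists (phi : nat -> dual E) (psi : nat -> F),
    cvgn (series (fun n => `|phi n| * `|psi n|)) /\
    forall v, (series (fun n => phi n v *: psi n) @ \oo --> T v).

Definition separable (T : topologicalType) :=
  exists2 D : set T, countable D & dense D.

Definition tensor {X : hilbertType R} (u v : X) : X := inner v u *: u.

End operators.

Section random_vectors.
Context {R : realType}.

Definition borel (T : topologicalType) : set (set T) := <<s @open T >>.

Definition random_vector {d} {Omega : measurableType d} {T : topologicalType}
    (x : Omega -> T) :=
  forall B, borel B -> measurable (x @^-1` B).

Definition square_integrable {d} {Omega : measurableType d}
    (P : probability Omega R) {E : normedModType R} (x : Omega -> E) :=
  random_vector x /\ ('E_P[fun w => (`|x w| ^+ 2)%R] < +oo)%E.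

(* the mean and the covariance are Pettis integrals, which coincide with the
   Bochner ones for square-integrable vectors *)
Definition is_mean {d} {Omega : measurableType d} (P : probability Omega R)
    {X : hilbertType R} (x : Omega -> X) (mu : X) :=
  forall v, 'E_P[fun w => inner (x w) v] = (inner mu v)%:E.

Definition is_covariance {d} {Omega : measurableType d}
    (P : probability Omega R) {X : hilbertType R} (x : Omega -> X) (mu : X)
    (S : X -> X) :=
  forall u v, 'E_P[fun w => inner (x w - mu) u * inner (x w - mu) v]
              = (inner (S u) v)%:E.

Definition sub_Gaussian {d} {Omega : measurableType d} (P : probability Omega R)
    {X : hilbertType R} (kappa : R) (x : Omega -> X) :=
  forall (v : X) (p : R), 1 < p ->
    ('N[P]_(p%:E)[(fun w => (inner (x w) v)%:E)] <=
     (kappa * Num.sqrt p)%:E * 'N[P]_(2%:E)[(fun w => (inner (x w) v)%:E)])%E.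

(* linearity holds in the space of random variables, i.e. almost surely *)
Definition linear_process {d} {Omega : measurableType d}
    (P : probability Omega R) {Y : hilbertType R} (S : Y -> Y)
    (eps : Y -> Omega -> R) :=
  [/\ forall v, measurable_fun setT (eps v),
      forall (a : R) u v,
        {ae P, forall w, eps (a *: u + v) w = a * eps u w + eps v w},
      forall v, 'E_P[eps v] = 0%E &
      forall u v, 'E_P[fun w => eps u w * eps v w] = (inner (S u) v)%:E].

(* [epsK] is the [K^*]-valued random vector associated with the process [eps];
   it is unique up to almost sure equality *)
Definition dual_noise {d} {Omega : measurableType d} (P : probability Omega R)
    {K : normedModType R} {Y : hilbertType R} (iota : K -> Y)
    (eps : Y -> Omega -> R) (epsK : Omega -> dual K) :=
  [/\ square_integrable P epsK,
      forall v, 'E_P[fun w => epsK w v] = 0%E &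
      forall v, {ae P, forall w, epsK w v = eps (iota v) w}].

Definition independent_process {d} {Omega : measurableType d}
    (P : probability Omega R) {X : topologicalType} {Y : Type}
    (x : Omega -> X) (eps : Y -> Omega -> R) :=
  forall (n : nat) (v : 'I_n -> Y) (B : set X) (C : 'I_n -> set R),
    borel B -> (forall i, measurable (C i)) ->
    P (x @^-1` B `&` \bigcap_i (eps (v i) @^-1` C i)) =
    (P (x @^-1` B) * P (\bigcap_i (eps (v i) @^-1` C i)))%E.

Definition iid_copies {d d'} {Omega : measurableType d}
    {Omega' : measurableType d'} (P : probability Omega R)
    (Q : probability Omega' R) {X : topologicalType} (x : Omega -> X) (m : nat)
    (xs : 'I_m -> Omega' -> X) :=
  [/\ forall i, random_vector (xs i),
      forall i B, borel B -> Q (xs i @^-1` B) = P (x @^-1` B) &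
      forall B : 'I_m -> set X, (forall i, borel (B i)) ->
        Q (\bigcap_i (xs i @^-1` B i)) = (\prod_i Q (xs i @^-1` B i))%E].

Definition sample_mean {X : hilbertType R} {T : Type} (m : nat)
    (xs : 'I_m -> T -> X) (w : T) : X :=
  m%:R^-1 *: \sum_i xs i w.

Definition sample_covariance {X : hilbertType R} {T : Type} (m : nat)
    (xs : 'I_m -> T -> X) (w : T) (v : X) : X :=
  m%:R^-1 *: \sum_i tensor (xs i w - sample_mean xs w) v.

End random_vectors.

Section reconstruction.
Context {R : realType} {X Y K : hilbertType R}.
Variables (A : X -> Y) (iota : K -> Y) (Se : Y -> Y).

(* the bounded extension of [B^2 A^* (iota^* (A B^2 A^* + Se))^-1] to [K^*]; it is
   unique when [iota^* (A B^2 A^* + Se)] has dense range *)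
Definition gain (B : X -> X) : dual K -> X :=
  xget (fun=> 0) [set W | bounded_extension
    (fun u => dual_adjoint iota (A (B (B (adjoint A u))) + Se u))
    (fun u => B (B (adjoint A u))) W].

Definition reconstruction (h : X) (B : X -> X) (y : dual K) : X :=
  h + gain B (y - dual_adjoint iota (A h)).

Definition observation {Omega : Type} (x : Omega -> X) (epsK : Omega -> dual K)
    (w : Omega) : dual K :=
  dual_adjoint iota (A (x w)) + epsK w.

Definition expected_error {d} {Omega : measurableType d}
    (P : probability Omega R) (x : Omega -> X) (epsK : Omega -> dual K)
    (h : X) (B : X -> X) : \bar R :=
  'E_P[fun w =>
    `|reconstruction h B (observation x epsK w) - x w| ^+ 2].

End reconstruction.

(* Main.v *)
(* Let At be the adjoint of A, S the covariance of x, S1 the sample covariance,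
   and W the bounded extension of the operator of hypothesis (iii), which maps
   iota^* (Se u + A (S (At u))) to At u.  The optimal gain is S W and the gain of
   the empirical pair is S1 (I + N)^-1 W, where N = W iota^* A (S1 - S) is small
   with S1 - S.  The difference of the squared reconstruction errors is thus
   pointwise at most a constant times
   max(|h - mu|, |S1 - S|) (1 + |x - mu|^2 + |W eps|^2).
   Here E|x - mu|^2 is the trace of S, and E|W eps|^2 is the sum over a Parseval
   frame (e_j) of <Se y_j, y_j>, where Se y_j + A (S (At y_j)) = A e_j, which does
   not involve K.

   The coordinates in the frame of the empirical mean and of the empirical second
   moment are averages of products of two coordinates of (1, x), which are
   sub-exponential.  Their deviations have moments of order 2k bounded by powers
   of k m; the convexity of t^k, with weights proportional to the squared scales
   of the coordinates, turns these bounds into a moment of order k of the squared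
   Hilbert-Schmidt norm of the whole deviation, and Markov's inequality applies
   with k close to tau.  The exponential moments are controlled on a bounded
   interval only, hence the condition k <= m. *)
From HB Require Import structures.
Require Import Defs.
From mathcomp Require Import all_boot all_order all_algebra.
From mathcomp Require Import all_classical all_reals all_analysis.
From mathcomp Require Import measurable_realfun ring lra.

Set Implicit Arguments.
Unset Strict Implicit.
Unset Printing Implicit Defensive.

Import Order.TTheory GRing.Theory Num.Theory.
Import numFieldNormedType.Exports.

Local Open Scope classical_set_scope.
Local Open Scope ring_scope.

(** * Bounded operators on Hilbert spaces *)

Section linear_maps.
Context {R : realType}.

(** The constants are fixed before [K], [iota], the random variables and the sample, whereas the
    norm of [W] may depend on [K], so that norm must not enter any constant of the result. Two facts
    seen from [Y] replace it: the bound [b] of the inverse of [Se] makes [Se + A S At] coercive,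
    which controls [W iota^*]; and [W eps], tested against a vector of [X], is the process at a
    vector of [Y]. The formula for the empirical gain comes from writing [Se + A S1 At] as
    [Se + A S At] plus [A (S1 - S) At]: after [iota^*], [W] sends this sum to [(I + N) At]. Only the
    squares of the operators [B] enter the gains, so square roots are never compared. A Parseval
    frame is used rather than an orthonormal basis because it is indexed by [nat] in every
    dimension, zero vectors being allowed. The order [k] of the moments follows [tau], and [m0]
    depends on [tau] through it. *)

Lemma linear_pack (V W : lmodType R) (f : V -> W) :
  linear f -> exists g : {linear V -> W}, g = f :> (V -> W).
Proof.
move=> lf.
by exists (HB.pack_for {linear V -> W} f (GRing.isLinear.Build R V W _ _ lf)).
Qed.

Lemma linear_continuous_bound (V W : normedModType R) (f : {linear V -> W}) :
  continuous f -> exists2 C, 0 < C & forall v, `|f v| <= C * `|v|.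
Proof.
move=> /linear_bounded_continuous/linear_boundedP/pinfty_ex_gt0[C C0 fC].
by exists C.
Qed.

Lemma linear_bound_continuous (V W : normedModType R) (f : {linear V -> W})
    (C : R) :
  (forall v, `|f v| <= C * `|v|) -> continuous f.
Proof.
move=> fC; apply/linear_bounded_continuous/linear_boundedP.
near=> M => v; apply: le_trans (fC v) _; apply: ler_wpM2r => //.
Unshelve. all: by end_near. Qed.

Lemma cvg_of_cauchy_rate (V : completeNormedModType R) (u : nat -> V) :
  (forall n m, `|u n - u m| <= n.+1%:R^-1 + m.+1%:R^-1) -> cvgn u.
Proof.
move=> uP; apply: cauchy_cvg; apply: cauchy_exP => e e0.
have e2 : 0 < e / 2 by rewrite divr_gt0.
have [N _ NP] := near_infty_natSinv_lt (PosNum e2).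
exists (u N), N => // m /= Nm; rewrite -ball_normE /=.
apply: le_lt_trans (uP N m) _; rewrite [e]splitr.
have /= hN := NP N (leqnn N); have /= hm := NP m Nm.
exact: ltrD.
Qed.

(** The solutions of [L u = y] are the fixed points of [u - t (L u - y)], a [q]-contraction in
    [u]. *)
Lemma contraction_surj (V : completeNormedModType R) (L : {linear V -> V})
    (t q : R) :
  0 <= q -> q < 1 -> t != 0 -> (forall u, `|u - t *: L u| <= q * `|u|) ->
  forall y, exists u, L u = y.
Proof.
move=> q0 q1 t0 LP y.
pose f (u : V) := u - t *: (L u - y).
pose F : {fun [set: V] >-> [set: V]} :=
  HB.pack f (@isFun.Build _ _ setT setT f (fun _ _ => I)).
have ctr : is_contraction F.
  exists (NngNum q0); split => // -[u v] _ /=.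
  rewrite (_ : f u - f v = (u - v) - t *: L (u - v)); first exact: LP.
  rewrite /f [L (u - v)]linearB !scalerBr !opprB !addrA.
  by rewrite [LHS](ACl (1*6*4*3*2*5))/= addrK.
have [u _ /eqP] := banach_fixed_point ctr closedT (ex_intro _ 0 I).
rewrite /F/= /f -subr_eq0 opprB addrC subrK scaler_eq0 (negbTE t0) /= subr_eq0.
by move=> /eqP Ly; exists u.
Qed.

End linear_maps.

(** * Riesz representation, adjoints and Parseval frames *)

Section hilbert.
Context {R : realType}.
Implicit Types X Y K : hilbertType R.

Lemma innerNl X (u v : X) : inner (- u) v = - inner u v.
Proof. by rewrite -scaleN1r innerZl mulN1r. Qed.

Lemma innerNr X (u v : X) : inner u (- v) = - inner u v.
Proof. by rewrite innerC innerNl innerC. Qed.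

Lemma innerBl X (u v w : X) : inner (u - v) w = inner u w - inner v w.
Proof. by rewrite innerDl innerNl. Qed.

Lemma innerBr X (u v w : X) : inner w (u - v) = inner w u - inner w v.
Proof. by rewrite innerDr innerNr. Qed.

Lemma inner0r X (u : X) : inner u 0 = 0.
Proof. by rewrite innerC inner0l. Qed.

Lemma inner_suml X (I : Type) (s : seq I) (F : I -> X) v :
  inner (\sum_(i <- s) F i) v = \sum_(i <- s) inner (F i) v.
Proof.
elim: s => [|i s ih]; first by rewrite !big_nil inner0l.
by rewrite !big_cons innerDl ih.
Qed.

Lemma inner_eqP X (u v : X) : (forall w, inner u w = inner v w) -> u = v.
Proof.
move=> uv; apply/eqP; rewrite -subr_eq0 -normr_eq0 -sqrf_eq0 -inner_norm.
by rewrite innerBl uv subrr.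
Qed.

Lemma norm_le_inner X (u : X) (C : R) : 0 <= C ->
  (forall w, `|inner u w| <= C * `|w|) -> `|u| <= C.
Proof.
move=> C0 /(_ u); have [->|u0] := eqVneq u 0; first by rewrite normr0.
rewrite inner_norm ger0_norm ?exprn_ge0// expr2 ler_pM2r//.
by rewrite normr_gt0.
Qed.

Lemma inner_continuousl X (v : X) : continuous (fun u : X => inner u v).
Proof.
have lf : linear (fun u => inner u v : R^o).
  by move=> a u w; rewrite innerDl innerZl.
have [g gE] := linear_pack lf.
have -> : (fun u => inner u v) = g by rewrite gE.
apply: (@linear_bound_continuous _ _ _ _ `|v|) => u.
by rewrite gE mulrC; exact: Cauchy_Schwarz.
Qed.

(* The representative is the limit of a minimising sequence of [|v|^2 - 2 f v]. *)
Lemma riesz X (f : X -> R) (C : R) :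
  linear (f : X -> R^o) -> (forall v, `|f v| <= C * `|v|) ->
  exists z, forall v, f v = inner v z.
Proof.
move=> /linear_pack[g gE] fC; have fE v : f v = g v by rewrite gE.
pose J v := `|v| ^+ 2 - 2 * f v.
have J_lb : has_inf (range J).
  split; first by exists (J 0), 0.
  exists (- C ^+ 2) => _ [v _ <-]; rewrite /J.
  have := fC v; rewrite ler_norml => /andP[_ fv].
  have : 0 <= (`|v| - C) ^+ 2 by rewrite sqr_ge0.
  nra.
have approx e : 0 < e ->
    exists u, forall v, `|inner u v - f v| <= e * `|v|.
  move=> e0; have e2 : 0 < e ^+ 2 by rewrite exprn_gt0.
  have [_ [u _ <-] Ju] := inf_adherent e2 J_lb.
  exists u => v; set g0 := inner u v - f v.
  (* First variation at a near-minimiser: [J u] exceeds the infimum by less than [e^2], so moving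
     along [v] cannot gain more. The minimising [t], namely [- g0 / |v|^2], gives
     [|g0| <= e |v|]. *)
  have quad t : 0 <= e ^+ 2 + 2 * t * g0 + t ^+ 2 * `|v| ^+ 2.
    have Jt : inf (range J) <= J (u + t *: v).
      by apply: ge_inf; [exact: J_lb.2|exists (u + t *: v)].
    have JE : J (u + t *: v) = J u + 2 * t * g0 + t ^+ 2 * `|v| ^+ 2.
      have gE' : f (u + t *: v) = f u + t * f v by rewrite !fE linearD linearZ.
      rewrite /J /g0 -!inner_norm !(innerDl, innerDr, innerZl, innerZr) gE'.
      by rewrite (innerC v u); ring.
    rewrite -subr_ge0 JE in Jt; have := ltW Ju; lra.
  have [v0|v0] := eqVneq v 0.
    by rewrite /g0 v0 inner0r fE linear0 subrr !normr0 mulr0.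
  have nv : 0 < `|v| by rewrite normr_gt0.
  rewrite -(@ler_pXn2r _ 2)// ?nnegrE ?mulr_ge0// ?(ltW e0)//.
  rewrite real_normK ?num_real// exprMn.
  have := quad (- g0 / `|v| ^+ 2).
  have -> : e ^+ 2 + 2 * (- g0 / `|v| ^+ 2) * g0 +
      (- g0 / `|v| ^+ 2) ^+ 2 * `|v| ^+ 2 = e ^+ 2 - g0 ^+ 2 / `|v| ^+ 2.
    by field; rewrite gt_eqF.
  by rewrite subr_ge0 ler_pdivrMr// exprn_gt0.
have /choice[u uP] (n : nat) := approx n.+1%:R^-1 ltac:(by rewrite invr_gt0).
have cu : cvgn u.
  apply: cvg_of_cauchy_rate => n m.
  apply: norm_le_inner => [|w]; first by rewrite addr_ge0.
  have -> : inner (u n - u m) w = (inner (u n) w - f w) - (inner (u m) w - f w).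
    by rewrite innerBl; ring.
  by rewrite mulrDl (le_trans (ler_normB _ _))// lerD.
exists (limn u) => v; rewrite innerC.
have lim1 : inner (u n) v @[n --> \oo] --> inner (limn u) v.
  by apply: (cvg_comp u (fun z => inner z v) cu); exact: inner_continuousl.
have lim2 : inner (u n) v @[n --> \oo] --> f v.
  apply/cvgrPdist_le => e e0.
  have v1 : 0 < `|v| + 1 by rewrite ltr_wpDl.
  have e1 : 0 < e / (`|v| + 1) by rewrite divr_gt0.
  apply: filterS (near_infty_natSinv_lt (PosNum e1)) => n /= /ltW ne.
  rewrite distrC (le_trans (uP n v))// (le_trans (ler_wpM2r _ ne))//.
  by rewrite -mulrA ger_pMr// mulrC ler_pdivrMr// mul1r lerDl.
exact: (cvg_unique _ lim2 lim1).
Qed.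

(** Riesz makes the defining set of [adjoint] nonempty, so [get] returns one of its elements. *)
Lemma adjointE X Y (A : {linear X -> Y}) : continuous A ->
  forall x y, inner (A x) y = inner x (adjoint A y).
Proof.
move=> /linear_continuous_bound[C _ AC] x y; rewrite /adjoint.
have [||z zP] := @riesz X (fun x => inner (A x) y) (C * `|y|).
- by move=> a u v /=; rewrite linearP innerDl innerZl.
- move=> v; rewrite (le_trans (Cauchy_Schwarz _ _))// mulrAC.
  by rewrite ler_wpM2r.
by have /getPex := ex_intro (fun z => forall x, inner (A x) y = inner x z) z zP.
Qed.

Lemma adjoint_bound X Y (A : {linear X -> Y}) (C : R) : continuous A ->
  0 <= C -> (forall v, `|A v| <= C * `|v|) ->
  forall y, `|adjoint A y| <= C * `|y|.
Proof.
move=> cA C0 AC y; apply: norm_le_inner => [|w]; first by rewrite mulr_ge0.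
rewrite innerC -adjointE// (le_trans (Cauchy_Schwarz _ _))// mulrAC.
by rewrite ler_wpM2r.
Qed.

Lemma adjoint_linear X Y (A : {linear X -> Y}) : continuous A ->
  linear (adjoint A).
Proof.
move=> cA a u v; apply: inner_eqP => w; rewrite innerDl innerZl.
by rewrite ![inner _ w]innerC -!adjointE// innerDr innerZr.
Qed.

(* Modified Gram-Schmidt: [T n] is the orthogonal projection onto the orthogonal
   complement of the first [n] vectors, and [inv 0 = 0] makes [e n = 0] when the
   [n]-th vector depends on the previous ones. *)
Lemma parseval_frame X : separable X -> exists e : nat -> X,
  forall u, (\sum_(0 <= j < n) inner u (e j) ^+ 2) @[n --> \oo] --> `|u| ^+ 2.
Proof.
move=> [D /countable_injP[f finj] dD].
(* A total enumeration of the dense set: an index outside the image of [f] yields the zero vector,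
   hence [e n = 0]. *)
pose d n := xget 0 [set x | D x /\ f x = n].
pose nrm (v : X) := `|v|^-1 *: v.
pose T := fix T n (v : X) : X := if n is p.+1 then
  T p v - inner (T p v) (nrm (T p (d p))) *: nrm (T p (d p)) else v.
pose e n := nrm (T n (d n)).
have TS n v : T n.+1 v = T n v - inner (T n v) (e n) *: e n by [].
have Tlin n : linear (T n).
  elim: n => [//|n ih] a u v; rewrite !TS ih innerDl innerZl scalerDl scalerBr.
  by move: (e n) => E; rewrite scalerA opprD addrACA.
have TZ n a v : T n (a *: v) = a *: T n v.
  by have [g gE] := linear_pack (Tlin n); rewrite -gE linearZ.
have TB n u v : T n (u - v) = T n u - T n v.
  by have [g gE] := linear_pack (Tlin n); rewrite -gE linearB.
(* One identity for both cases, [e n] of norm 1 and [e n = 0], so that the later computations need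
   no case distinction. *)
have e01 n : (1 - inner (e n) (e n)) *: e n = 0.
  rewrite /e /nrm; have [->|v0] := eqVneq (T n (d n)) 0; first by rewrite !scaler0.
  rewrite innerZl innerZr inner_norm expr2 mulKf ?normr_eq0//.
  by rewrite mulVf ?normr_eq0// subrr scale0r.
have [Tsym Tid] : (forall n u v, inner (T n u) v = inner u (T n v)) /\
                  (forall n v, T n (T n v) = T n v).
  suff H n : (forall u v, inner (T n u) v = inner u (T n v)) /\
     (forall v, T n (T n v) = T n v) by split=> n; have [] := H n.
  elim: n => [//|n [sym id]].
  have Te : T n (e n) = e n by rewrite /e /nrm TZ id.
  split => [u v|v]; rewrite !TS.
    rewrite innerBl innerBr innerZl innerZr sym [inner (T n v) _]sym.
    by rewrite [inner (T n u) _]sym Te (innerC v) mulrC.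
  rewrite TB id TZ Te innerBl innerZl sym Te.
  have := e01 n; move: (e n) => E e0.
  rewrite -[RHS]subr0 -(scaler0 X (inner v E)) -e0 scalerA mulrBr mulr1.
  by [].
have Te n : T n (e n) = e n by rewrite /e /nrm TZ Tid.
have Tnorm n v : `|T n.+1 v| ^+ 2 = `|T n v| ^+ 2 - inner v (e n) ^+ 2.
  have := e01 n; have := Te n; rewrite TS; move: (e n) => E TE E1.
  rewrite -!inner_norm !(innerBl, innerBr, innerZl, innerZr).
  rewrite (innerC E) [inner (T n v) E]Tsym TE.
  have : inner v E * (1 - inner E E) = 0 by rewrite mulrC -innerZr E1 inner0r.
  by rewrite mulrBr mulr1 => /subr0_eq <-; ring.
have Tsum n v : `|T n v| ^+ 2 = `|v| ^+ 2 - \sum_(0 <= j < n) inner v (e j) ^+ 2.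
  elim: n => [|n ih]; first by rewrite big_geq// subr0.
  by rewrite big_nat_recr//= Tnorm ih opprD addrA.
have Tmon v n m : (n <= m)%N -> `|T m v| <= `|T n v|.
  move=> nm; rewrite -(@ler_pXn2r _ 2)// ?nnegrE// -(subnK nm).
  elim: (m - n)%N => // k ih; rewrite addSn Tnorm.
  by rewrite lerBlDr (le_trans ih)// lerDl sqr_ge0.
have Tle n v : `|T n v| <= `|v| by exact: (Tmon v 0 n).
have Td n : T n.+1 (d n) = 0.
  rewrite TS /e /nrm; set r := T n (d n).
  have [->|r0] := eqVneq r 0; first by rewrite inner0l scale0r subrr.
  rewrite innerZr inner_norm scalerA expr2 mulKf ?normr_eq0//.
  by rewrite mulfV ?normr_eq0// scale1r subrr.
exists e => u.
(* A point [x] of the dense set close to [u] is killed by [T n] as soon as [n] exceeds its index,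
   and [T n] does not increase norms. *)
have T0 : T n u @[n --> \oo] --> (0 : X).
  apply/cvgrPdist_lt => eps eps0.
  have [x [Dx xu]] : D `&` (ball u eps : set X) !=set0.
    rewrite setIC; apply: dD; last exact: ball_open.
    by exists u; exact: ballxx.
  exists (f x).+1 => // n /= fxn; rewrite sub0r normrN.
  have dx : d (f x) = x.
    have [] := xgetPex 0 (ex_intro (fun y => D y /\ f y = f x) x (conj Dx erefl)).
    by rewrite -/(d (f x)) => Dd fd; apply: finj => //; rewrite inE.
  have : `|T n x| <= 0 by rewrite -(normr0 X) -(Td (f x)) dx; exact: Tmon.
  rewrite normr_le0 => /eqP Tx.
  rewrite -[T n u]subr0 -Tx -TB; apply: le_lt_trans (Tle _ _) _.
  by move: xu; rewrite -ball_normE.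
have -> : (fun n => \sum_(0 <= j < n) inner u (e j) ^+ 2) =
          (fun n => `|u| ^+ 2 - `|T n u| ^+ 2).
  by apply/funext => n; rewrite Tsum opprB addrC subrK.
have N0 : `|T n u| @[n --> \oo] --> 0 by rewrite -(normr0 X); exact: cvg_norm.
rewrite -[X in _ --> X]subr0; apply: cvgB; first exact: cvg_cst.
by rewrite -[X in _ --> X](mulr0 0); apply: cvgM.
Qed.

End hilbert.

(** * Perturbation of the gain *)

Section coercive.
Context {R : realType}.

(** Lax-Milgram by contraction: with [|L u| <= D |u|] and [t = c / D^2], expanding [|u - t L u|^2]
    gives at most [(1 - c^2 / D^2) |u|^2]. The choice [D = |C| + c] ensures [c <= D], so that this
    factor is non-negative. *)
Lemma coercive_surj (X : hilbertType R) (L : {linear X -> X}) (c C : R) :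
  0 < c -> (forall u, c * `|u| ^+ 2 <= inner (L u) u) ->
  (forall u, `|L u| <= C * `|u|) -> forall y, exists u, L u = y.
Proof.
move=> c0 Lc LC.
pose D := `|C| + c.
have D0 : 0 < D by rewrite ltr_wpDl.
have LD u : `|L u| <= D * `|u|.
  rewrite (le_trans (LC u))// ler_wpM2r// (le_trans (ler_norm _))//.
  by rewrite lerDl ltW.
have cD : c <= D by rewrite /D lerDr.
have D20 : 0 < D ^+ 2 by rewrite exprn_gt0.
have q0 : 0 <= 1 - c ^+ 2 / D ^+ 2.
  by rewrite subr_ge0 ler_pdivrMr// mul1r ler_pXn2r// nnegrE ltW.
apply: (@contraction_surj _ _ L (c / D ^+ 2) (Num.sqrt (1 - c ^+ 2 / D ^+ 2))).
- exact: sqrtr_ge0.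
- rewrite -[ltRHS]sqrtr1 ltr_sqrt// gtrBl divr_gt0// exprn_gt0//.
- by rewrite gt_eqF// divr_gt0.
move=> u; rewrite -(@ler_pXn2r _ 2)// ?nnegrE ?mulr_ge0 ?sqrtr_ge0//.
rewrite exprMn sqr_sqrtr// -inner_norm !(innerBl, innerBr, innerZl, innerZr).
rewrite (innerC u (L u)) !inner_norm.
set t := c / D ^+ 2.
have t0 : 0 <= t by rewrite divr_ge0 ?ltW.
have h1 := ler_wpM2l t0 (Lc u).
have h2 : t * (t * `|L u| ^+ 2) <= t * c * `|u| ^+ 2.
  rewrite -mulrA ler_wpM2l//.
  have -> : c * `|u| ^+ 2 = t * (D * `|u|) ^+ 2.
    by rewrite /t; field; rewrite gt_eqF.
  by rewrite ler_wpM2l// ler_pXn2r ?nnegrE ?mulr_ge0// ltW.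
have -> : (1 - c ^+ 2 / D ^+ 2) * `|u| ^+ 2 = `|u| ^+ 2 - t * c * `|u| ^+ 2.
  by rewrite /t; field; rewrite gt_eqF.
lra.
Qed.

(** Cauchy-Schwarz for the form [<S u, v>], applied to [u] and [T u], for which [<S u, T u> = |u|^2]
    and [<S (T u), T u> <= b |u|^2]. It is read off the form at [u + t T u], with [t = - 1 / b]. *)
Lemma coercive_of_inverse (X : hilbertType R) (S : {linear X -> X}) (T : X -> X)
    (b : R) : 0 < b ->
  (forall u v, inner (S u) v = inner u (S v)) ->
  (forall u, 0 <= inner (S u) u) -> cancel T S ->
  (forall u, `|T u| <= b * `|u|) ->
  forall u, `|u| ^+ 2 <= b * inner (S u) u.
Proof.
move=> b0 Ssym S0 TS Tb u.
have [->|u0] := eqVneq u 0.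
  by rewrite normr0 expr0n inner0r mulr0.
have nu : 0 < `|u| ^+ 2 by rewrite exprn_gt0// normr_gt0.
set p := inner (S u) u; pose q := inner (S (T u)) (T u).
have quad t : 0 <= p + 2 * t * `|u| ^+ 2 + t ^+ 2 * q.
  have := S0 (u + t *: T u).
  rewrite linearD linearZ /= !(innerDl, innerDr, innerZl, innerZr).
  rewrite [inner (S u) (T u)]Ssym (innerC u) !TS inner_norm.
  have -> : inner u (T u) = q by rewrite /q TS.
  rewrite -/p => h; rewrite (_ : p + 2 * t * `|u| ^+ 2 + t ^+ 2 * q =
    p + t * `|u| ^+ 2 + (t * `|u| ^+ 2 + t * (t * q)))//; ring.
have qb : q <= b * `|u| ^+ 2.
  rewrite /q TS (le_trans (ler_norm _))// (le_trans (Cauchy_Schwarz _ _))//.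
  by rewrite expr2 mulrA mulrC ler_wpM2r.
have := quad (- b^-1); rewrite sqrrN.
have h : b^-1 ^+ 2 * q <= b^-1 * `|u| ^+ 2.
  apply: le_trans (ler_wpM2l _ qb) _; first exact: sqr_ge0.
  by rewrite mulrA expr2 -[b^-1 * b^-1 * b]mulrA mulVf ?gt_eqF// mulr1.
have : 2 * - b^-1 * `|u| ^+ 2 = - (2 * (b^-1 * `|u| ^+ 2)) by ring.
move=> -> h2; rewrite -ler_pdivrMl//; lra.
Qed.

Lemma near_identity_inverse (X : hilbertType R) (N : {linear X -> X}) :
  (forall u, `|N u| <= 2^-1 * `|u|) ->
  exists rho : {linear X -> X},
    [/\ forall u, rho u + N (rho u) = u, forall u, rho (u + N u) = u &
        forall u, `|rho u| <= 2 * `|u|].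
Proof.
move=> Nle; pose L : {linear X -> X} := (idfun \+ N)%R.
have Ls y : exists u, L u = y.
  apply: (@contraction_surj _ _ L 1 2^-1) => //.
    by rewrite invf_lt1// ltr1n.
  by move=> u; rewrite scale1r /L /= opprD addNKr normrN.
have low u : `|u| <= 2 * `|L u|.
  have : `|u| <= `|L u| + `|N u|.
    by rewrite -[X in `|X| <= _](addrK (N u)) ler_normB.
  by have := Nle u; lra.
have inj u v : L u = L v -> u = v.
  move=> uv; apply/eqP; rewrite -subr_eq0 -normr_le0.
  by rewrite (le_trans (low _))// linearB uv subrr normr0 mulr0.
have /choice[r rP] := Ls.
have lr : linear r by move=> a u v; apply: inj; rewrite linearP !rP.
have [rho rhoE] := linear_pack lr.
exists rho; rewrite rhoE; split => u; first exact: rP.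
- by apply: inj; rewrite rP.
- by rewrite (le_trans (low _))// rP.
Qed.

End coercive.

(** * Uniqueness of the gain and stability of the reconstruction *)

Section gain.
Context {R : realType} {X Y K : hilbertType R}.
Variables (A : {linear X -> Y}) (iota : {linear K -> Y}) (Se : {linear Y -> Y}).
Hypotheses (cA : continuous A) (ci : continuous iota) (ii : injective iota).

(* [K] is reflexive: a vector of [K^**] is the evaluation at a vector of [K]. *)
Lemma dual_evaluation (W : {linear dual K -> X}) (u : X) : continuous W ->
  exists k, forall phi, inner (W phi) u = phi k.
Proof.
move=> /linear_continuous_bound[C C0 WC].
pose J : K -> dual K := dual_adjoint (idfun : {linear K -> K}).
have JE k v : J k v = inner k v by rewrite dual_adjointE// => ?; exact: cvg_id.
have JD a k l : J (a *: k + l) = a *: J k + J l.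
  by apply: dual_eq => v; rewrite dualD dualZ !JE innerDl innerZl.
have Jn k : `|J k| <= `|k|.
  apply: dual_norm_le => v v1; rewrite JE (le_trans (Cauchy_Schwarz _ _))//.
  by rewrite ler_piMr.
have [||z zP] := @riesz R K (fun k => inner (W (J k)) u) (C * `|u|).
- by move=> a k l /=; rewrite JD linearP innerDl innerZl.
- move=> k; rewrite (le_trans (Cauchy_Schwarz _ _))// mulrAC ler_wpM2r//.
  by rewrite (le_trans (WC _))// ler_wpM2l// ltW.
exists z => phi.
have [||k kP] := @riesz R K phi `|phi|; first exact: dual_linear.
- exact: dual_normP.
have -> : phi = J k by apply: dual_eq => v; rewrite JE kP innerC.
by rewrite zP JE.
Qed.

(** Density of the range of [iota^*] in disguise: tested against [u], both operators are evaluations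
    at vectors [k] and [l] of [K], whose images under [iota] have the same inner products with all
    of [Y]; injectivity of [iota] gives [k = l]. *)
Lemma dual_adjoint_cancel (W W' : {linear dual K -> X}) :
  continuous W -> continuous W' ->
  (forall y, W (dual_adjoint iota y) = W' (dual_adjoint iota y)) ->
  W =1 W'.
Proof.
move=> cW cW' WW' phi; apply: inner_eqP => u.
have [k kP] := dual_evaluation u cW; have [l lP] := dual_evaluation u cW'.
rewrite kP lP (_ : k = l)//; apply: ii; apply: inner_eqP => y.
by rewrite ![inner (iota _) y]innerC -!dual_adjointE// -kP -lP WW'.
Qed.

Lemma dual_adjointD y z :
  dual_adjoint iota (y + z) = dual_adjoint iota y + dual_adjoint iota z.
Proof.
by apply: dual_eq => v; rewrite dualD !dual_adjointE// innerDl.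
Qed.

Lemma dual_adjointB y z :
  dual_adjoint iota (y - z) = dual_adjoint iota y - dual_adjoint iota z.
Proof.
by rewrite -[LHS](addrK (dual_adjoint iota z)) -dual_adjointD subrK.
Qed.

Variables (b : R).
Hypotheses (b0 : 0 < b) (cSe : continuous Se)
  (Se_coercive : forall u, `|u| ^+ 2 <= b * inner (Se u) u).

Lemma perturbed_coercive (S : X -> X) : (forall v, 0 <= inner (S v) v) ->
  forall y, `|y| ^+ 2 <= b * inner (A (S (adjoint A y)) + Se y) y.
Proof.
move=> S0 y; rewrite (le_trans (Se_coercive y))// ler_pM2l//.
by rewrite innerDl lerDr adjointE.
Qed.

(** Consequently the partially defined operator extended by a gain has the whole range of [iota^*]
    as its domain. *)
Lemma perturbed_surj (S : {linear X -> X}) : continuous S ->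
  (forall v, 0 <= inner (S v) v) ->
  forall y, exists u, A (S (adjoint A u)) + Se u = y.
Proof.
move=> cS S0.
have [At AtE] := linear_pack (adjoint_linear cA).
have [cA' [a0 ac]] : exists cA', 0 < cA' /\ forall v, `|A v| <= cA' * `|v|.
  by have [c h1 h2] := linear_continuous_bound cA; exists c.
have [cS' s0 Sc] := linear_continuous_bound cS.
have [e e0 ec] := linear_continuous_bound cSe.
have Atc := adjoint_bound cA (ltW a0) ac.
pose L : {linear Y -> Y} := ((A \o (S \o At)) \+ Se)%R.
have LE u : L u = A (S (adjoint A u)) + Se u by rewrite /L /= AtE.
have : forall y, exists u, L u = y.
  apply: (@coercive_surj _ _ L b^-1 (cA' * (cS' * cA') + e)) => [|u|u].
  - by rewrite invr_gt0.
  - by rewrite LE ler_pdivrMl//; exact: perturbed_coercive.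
  - rewrite LE (le_trans (ler_normD _ _))// mulrDl lerD//.
    rewrite (le_trans (ac _))// -!mulrA ler_pM2l// (le_trans (Sc _))//.
    by rewrite ler_pM2l.
by move=> Ls y; have [u <-] := Ls y; exists u; rewrite LE.
Qed.

(** Exhibiting one bounded extension keeps [xget] away from its default value; any two extensions
    agree on the range of [iota^*], hence everywhere. *)
Lemma gain_eq (B : X -> X) (W : {linear dual K -> X}) : positive_op B ->
  continuous W ->
  (forall u, W (dual_adjoint iota (A (B (B (adjoint A u))) + Se u)) =
             B (B (adjoint A u))) ->
  gain A iota Se B =1 W.
Proof.
move=> [lB cB Bsym B0] cW WE.
have [B' B'E] := linear_pack lB.
pose S : {linear X -> X} := (B' \o B')%R.
have SE v : S v = B (B v) by rewrite /S /= B'E.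
have cS : continuous S.
  move=> v; apply: continuous_comp; rewrite B'E; exact: cB.
have S0 v : 0 <= inner (S v) v by rewrite SE Bsym inner_norm exprn_ge0.
rewrite /gain; set Q := [set _ | _].
have QW : Q W by split => //; exact: linearP.
have [lg cg gE] : Q (xget (fun=> 0) Q) by exact: (xgetI _ QW).
have [g gE'] := linear_pack lg.
rewrite -gE'; apply: dual_adjoint_cancel => //; first by rewrite gE'.
move=> y; have [u <-] := perturbed_surj cS S0 y.
by rewrite !SE WE gE'.
Qed.

Variables (Sx : {linear X -> X}) (alpha sigma gamma : R).
Hypotheses (alpha0 : 0 <= alpha) (sigma0 : 0 <= sigma) (gamma0 : 0 <= gamma)
  (A_le : forall v, `|A v| <= alpha * `|v|)
  (Sx_le : forall v, `|Sx v| <= sigma * `|v|).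

(** [a] bounds the norm of [W iota^* A]. With [t = 1 + |x - mu| + |W eps|], the optimal error is at
    most [C1 t] and the two errors differ by at most [r C2 t]. The difference of squares costs
    [C2 (2 C1 + C2) <= (C1 + C2)^2], and 3 comes from [t^2 <= 3 (1 + |x - mu|^2 + |W eps|^2)]. *)
Definition error_constant : R :=
  let a := alpha ^+ 2 * b in
  let C1 := 1 + sigma * (a + 1) in
  let C2 := 1 + 2 * (sigma + gamma) * a +
            2 * gamma * (1 + sigma * a) * (a + 1) in
  3 * (C1 + C2) ^+ 2.

(* With [G0 = W iota^*] and [N = G0 A (Bh^2 - Sx)], the gain of the perturbed
   operator is [Bh^2 (I + N)^-1 W], whereas that of [Sx] is [Sx W]. *)
Lemma reconstruction_perturbation (W : {linear dual K -> X}) (Bs Bh : X -> X)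
    (mu h : X) (r : R) :
  continuous W ->
  (forall u, W (dual_adjoint iota (Se u + A (Sx (adjoint A u)))) = adjoint A u) ->
  is_sqrt Sx Bs -> positive_op Bh ->
  0 <= r -> r <= 1 -> alpha ^+ 2 * b * gamma * r <= 2^-1 ->
  `|h - mu| <= r -> (forall v, `|Bh (Bh v) - Sx v| <= gamma * r * `|v|) ->
  forall (x : X) (eps : dual K),
  let err g B := reconstruction A iota Se g B (dual_adjoint iota (A x) + eps) - x in
  `| `|err h Bh| ^+ 2 - `|err mu Bs| ^+ 2 | <=
    r * error_constant * (1 + `|x - mu| ^+ 2 + `|W eps| ^+ 2) /\
  `|err mu Bs| ^+ 2 <= error_constant * (1 + `|x - mu| ^+ 2 + `|W eps| ^+ 2).
Proof.
move=> cW WE [Bsp BsE] Bhp r0 r1 ar hmu Dle x eps err.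
have [At AtE] := linear_pack (adjoint_linear cA).
have [Bh' Bh'E] : exists g : {linear X -> X}, g = Bh :> (X -> X).
  by case: Bhp => /linear_pack.
pose Sh : {linear X -> X} := (Bh' \o Bh')%R.
have ShE v : Sh v = Bh (Bh v) by rewrite /Sh /= Bh'E.
pose D : {linear X -> X} := (Sh \- Sx)%R.
have DE v : D v = Sh v - Sx v by [].
have D_le v : `|D v| <= gamma * r * `|v| by rewrite DE ShE.
pose G0 y : X := W (dual_adjoint iota y).
have G0D y z : G0 (y + z) = G0 y + G0 z by rewrite /G0 dual_adjointD// linearD.
have G0Z c y : G0 (c *: y) = c *: G0 y.
  rewrite /G0 -linearZ /=; congr (W _); apply: dual_eq => v.
  by rewrite dualZ !dual_adjointE// innerZl.
have Sx_ge0 v : 0 <= inner (Sx v) v.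
  by case: Bsp => _ _ sym _; rewrite -BsE sym inner_norm exprn_ge0.
have cSx : continuous Sx by exact: linear_bound_continuous Sx_le.
set a := alpha ^+ 2 * b in ar *.
have a0 : 0 <= a by rewrite mulr_ge0 ?exprn_ge0// ltW.
(* This avoids the norm of [W]: if [u] solves the coercive equation with right-hand side [y], then
   [G0 y] is the adjoint of [A] at [u], and [|u| <= b |y|]. *)
have G0_le y : `|G0 y| <= alpha * b * `|y|.
  have [u <-] := perturbed_surj cSx Sx_ge0 y.
  rewrite [X in G0 X]addrC /G0 WE (le_trans (adjoint_bound cA alpha0 A_le u))//.
  rewrite -mulrA ler_wpM2l//.
  have := perturbed_coercive Sx_ge0 u.
  have [->|u0] := eqVneq u 0; first by rewrite normr0 mulr_ge0// ltW.
  set y' := A _ + _ => uy; have nu : 0 < `|u| by rewrite normr_gt0.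
  rewrite -(ler_pM2r nu) -expr2 (le_trans uy)// -mulrA ler_pM2l//.
  by rewrite [y']addrC (le_trans (ler_norm _))// Cauchy_Schwarz.
have GA_le v : `|G0 (A v)| <= a * `|v|.
  rewrite (le_trans (G0_le _))// /a expr2 -!mulrA ler_wpM2l// mulrCA mulrA.
  by rewrite -mulrA ler_pM2l.
have lGA : linear (fun v => G0 (A v)) by move=> c u v; rewrite linearP G0D G0Z.
have [GA GAE] := linear_pack lGA.
pose N : {linear X -> X} := (GA \o D)%R.
have NE v : N v = G0 (A (D v)) by rewrite /N /= GAE.
have N_le v : `|N v| <= a * gamma * r * `|v|.
  by rewrite NE (le_trans (GA_le _))// -[a * gamma * r]mulrA -mulrA ler_wpM2l.
have N_half v : `|N v| <= 2^-1 * `|v|.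
  by rewrite (le_trans (N_le v))// ler_wpM2r.
have [rho [rho1 rho2 rho_le]] := near_identity_inverse N_half.
have gs phi : gain A iota Se Bs phi = Sx (W phi).
  pose Ws : {linear dual K -> X} := (Sx \o W)%R.
  rewrite (gain_eq (W := Ws) Bsp)//.
    by move=> v; apply: continuous_comp; [exact: cW|exact: cSx].
  by move=> u; rewrite /Ws /= BsE [X in dual_adjoint _ X]addrC WE.
have gh phi : gain A iota Se Bh phi = Sh (rho (W phi)).
  pose Wh : {linear dual K -> X} := (Sh \o (rho \o W))%R.
  have [C C0 WC] := linear_continuous_bound cW.
  have Sh_le v : `|Sh v| <= (sigma + gamma * r) * `|v|.
    rewrite (_ : Sh v = Sx v + D v); last by rewrite DE addrC subrK.
    by rewrite mulrDl (le_trans (ler_normD _ _))// lerD.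
  rewrite (gain_eq (W := Wh) Bhp)//.
    apply: (@linear_bound_continuous _ _ _ _ ((sigma + gamma * r) * (2 * C))).
    move=> v; rewrite /Wh /= (le_trans (Sh_le _))// -mulrA ler_wpM2l//.
      by rewrite addr_ge0// mulr_ge0.
    by rewrite (le_trans (rho_le _))// -mulrA ler_pM2l.
  move=> u; rewrite -ShE /Wh /=; congr (Sh _).
  (* [W iota^*] maps the first summand to the adjoint at [u] and the second to [N] of it, so [rho]
     returns the adjoint at [u]. *)
  have -> : A (Sh (adjoint A u)) + Se u =
      (Se u + A (Sx (adjoint A u))) + A (D (adjoint A u)).
    by rewrite DE linearB/= -[RHS]addrA [_ + (_ - _)]addrC subrK addrC.
  by rewrite -/(G0 _) G0D [X in X + _]WE -NE rho2.
have W_obs g : W (dual_adjoint iota (A x) + eps - dual_adjoint iota (A g)) =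
    GA (x - g) + W eps.
  rewrite addrAC -dual_adjointB// linearD /= -linearB.
  by rewrite GAE.
pose p := GA (x - mu) + W eps.
have es_E : err mu Bs = Sx p - (x - mu).
  by rewrite /err /reconstruction gs W_obs -/p opprB [LHS](ACl (2*(1*3)))/=.
have GAb v : `|GA v| <= a * `|v| by rewrite GAE.
(* The shift of the centre, the change of gain acting on [p], and the perturbed gain acting on the
   shifted data; each accounts for one summand of [C2]. *)
have diff_E : err h Bh - err mu Bs = (h - mu) + (Sh (rho p) - Sx p)
    - Sh (rho (GA (h - mu))).
  rewrite /err /reconstruction gs gh !W_obs -/p.
  have -> : GA (x - h) + W eps = p - GA (h - mu).
    rewrite /p addrAC; congr (_ + _); rewrite -linearB; congr (GA _).
    by rewrite opprB addrA subrK.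
  have -> : rho (p - GA (h - mu)) = rho p - rho (GA (h - mu)) by exact: linearB.
  move: (rho p) (rho (GA (h - mu))) (Sx p) => s1 s2 s3.
  have -> : Sh (s1 - s2) = Sh s1 - Sh s2 by exact: linearB.
  by rewrite opprB addrA subrK opprD !addrA [LHS](ACl (1*4*2*5*3))/=.
set t := 1 + `|x - mu| + `|W eps|.
have p_le : `|p| <= (a + 1) * t.
  rewrite (le_trans (ler_normD _ _))// (le_trans (lerD (GAb _) (lexx _)))//.
  have : 0 <= a * (1 + `|W eps|) by rewrite mulr_ge0// addr_ge0.
  by rewrite /t; have := normr_ge0 (x - mu); lra.
have es_le : `|err mu Bs| <= (1 + sigma * (a + 1)) * t.
  rewrite es_E (le_trans (ler_normB _ _))// (le_trans (lerD (Sx_le _) (lexx _)))//.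
  have := ler_wpM2l sigma0 p_le; have := normr_ge0 (W eps).
  by rewrite mulrDl mul1r /t; nra.
have Shrho_le v : `|Sh (rho v)| <= 2 * (sigma + gamma) * `|v|.
  rewrite (_ : Sh (rho v) = Sx (rho v) + D (rho v)); last by rewrite DE addrC subrK.
  rewrite (le_trans (ler_normD _ _))// (le_trans (lerD (Sx_le _) (D_le _)))//.
  rewrite -mulrDl [2 * _]mulrC -mulrA.
  have h1 : sigma + gamma * r <= sigma + gamma by rewrite lerD2l ler_piMr.
  have := rho_le v.
  have h0 : 0 <= sigma + gamma * r by rewrite addr_ge0// mulr_ge0.
  by move=> h2; rewrite ler_pM.
have Srho_le : `|Sh (rho p) - Sx p| <= r * (2 * gamma * (1 + sigma * a)) * `|p|.
  (* Writing [p = rho p + N (rho p)] exposes a factor [D] in both terms, since [N] contains [D]. *)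
  have -> : Sh (rho p) - Sx p = D (rho p) - Sx (N (rho p)).
    have -> : Sx p = Sx (rho p) + Sx (N (rho p)).
      by rewrite -[in LHS](rho1 p); exact: linearD.
    by rewrite DE opprD addrA.
  rewrite (le_trans (ler_normB _ _))//.
  rewrite (le_trans (lerD (D_le _) (Sx_le _)))//.
  have := ler_wpM2l sigma0 (N_le (rho p)) => h1.
  rewrite (le_trans (lerD (lexx _) h1))//.
  have -> : gamma * r * `|rho p| + sigma * (a * gamma * r * `|rho p|) =
    r * gamma * (1 + sigma * a) * `|rho p| by ring.
  have -> : r * (2 * gamma * (1 + sigma * a)) * `|p| =
    r * gamma * (1 + sigma * a) * (2 * `|p|) by ring.
  by rewrite ler_wpM2l// !mulr_ge0// addr_ge0// mulr_ge0.
set C1 := 1 + sigma * (a + 1) in es_le.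
have bge0 := ltW b0.
pose C2 := 1 + 2 * (sigma + gamma) * a + 2 * gamma * (1 + sigma * a) * (a + 1).
have t1 : 1 <= t by rewrite /t -addrA lerDl addr_ge0.
have t0 : 0 <= t by exact: le_trans t1.
have C10 : 0 <= C1 by rewrite addr_ge0// mulr_ge0// addr_ge0.
have C20 : 1 <= C2.
  by rewrite /C2 -addrA lerDl; do ![apply: addr_ge0 | apply: mulr_ge0].
have diff_le : `|err h Bh - err mu Bs| <= r * C2 * t.
  rewrite diff_E (le_trans (ler_normB _ _))//.
  rewrite (le_trans (lerD (ler_normD _ _) (Shrho_le _)))//.
  have h1 : 2 * (sigma + gamma) * `|GA (h - mu)| <= r * (2 * (sigma + gamma) * a).
    have -> : r * (2 * (sigma + gamma) * a) = 2 * (sigma + gamma) * (a * r).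
      by ring.
    rewrite ler_wpM2l ?mulr_ge0 ?addr_ge0//.
    by rewrite (le_trans (GAb _))// ler_wpM2l.
  have h2 : `|Sh (rho p) - Sx p| <=
      r * (2 * gamma * (1 + sigma * a) * (a + 1)) * t.
    have -> : r * (2 * gamma * (1 + sigma * a) * (a + 1)) * t =
        r * (2 * gamma * (1 + sigma * a)) * ((a + 1) * t) by ring.
    rewrite (le_trans Srho_le)// ler_wpM2l//.
    by do ![apply: addr_ge0 | apply: mulr_ge0].
  have h3 : r * (1 + 2 * (sigma + gamma) * a) <=
            r * (1 + 2 * (sigma + gamma) * a) * t.
    by rewrite ler_peMr//; do ![apply: addr_ge0 | apply: mulr_ge0].
  by rewrite /C2; move: hmu h1 h2 h3; lra.
have t2 : t ^+ 2 <= 3 * (1 + `|x - mu| ^+ 2 + `|W eps| ^+ 2).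
  rewrite /t; set u := `|x - mu|; set v := `|W eps|.
  have := sqr_ge0 (1 - u); have := sqr_ge0 (1 - v); have := sqr_ge0 (u - v).
  by rewrite !expr2; lra.
have ec : error_constant = 3 * (C1 + C2) ^+ 2 by [].
have C12 : C2 * (2 * C1 + C2) <= (C1 + C2) ^+ 2.
  by have := sqr_ge0 C1; rewrite !expr2; lra.
split.
- rewrite subr_sqr normrM.
  have eh_le : `|err h Bh| + `|err mu Bs| <= (2 * C1 + C2) * t.
    have : `|err h Bh| <= `|err mu Bs| + `|err h Bh - err mu Bs|.
      by rewrite -[X in `|X| <= _](subrK (err mu Bs)) addrC ler_normD.
    have : r * C2 * t <= C2 * t.
      by rewrite -mulrA ler_piMl// mulr_ge0// (le_trans ler01).
    move: es_le diff_le; lra.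
  rewrite (@le_trans _ _ ((r * C2 * t) * ((2 * C1 + C2) * t)))//.
    rewrite ler_pM// ?(le_trans (ler_dist_dist _ _))//.
    by rewrite ger0_norm// addr_ge0.
  have -> : r * C2 * t * ((2 * C1 + C2) * t) = r * (C2 * (2 * C1 + C2) * t ^+ 2).
    by ring.
  rewrite ec; set Q := 1 + _ + _ in t2 *.
  have -> : r * (3 * (C1 + C2) ^+ 2) * Q = r * ((C1 + C2) ^+ 2 * (3 * Q)) by ring.
  have C2_ge0 : 0 <= C2 := le_trans ler01 C20.
  rewrite ler_wpM2l// ler_pM// ?exprn_ge0//.
  by do ![apply: addr_ge0 | apply: mulr_ge0].
- rewrite ec; set Q := 1 + _ + _ in t2 *.
  have -> : 3 * (C1 + C2) ^+ 2 * Q = (C1 + C2) ^+ 2 * (3 * Q) by ring.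
  have C2_ge0 : 0 <= C2 := le_trans ler01 C20.
  apply: (@le_trans _ _ ((C1 + C2) ^+ 2 * t ^+ 2)).
    have C12_ge0 : 0 <= C1 + C2 by rewrite -[0]addr0 lerD.
    rewrite -exprMn ler_pXn2r ?nnegrE ?mulr_ge0//.
    by rewrite (le_trans es_le)// ler_wpM2r// lerDl.
  by rewrite ler_wpM2l// sqr_ge0.
Qed.

End gain.

(** * Moments of sums of independent variables *)

Section real_inequalities.
Context {R : realType}.

(** Convexity as a tangent inequality, without derivatives: multiplying the case [k] by [b] exceeds
    the tangent for the next power by exactly [(k + 1) a^k (b - a)^2]. *)
Lemma exprn_tangent (a b : R) (k : nat) : 0 <= a -> 0 <= b ->
  a ^+ k.+1 + k.+1%:R * a ^+ k * (b - a) <= b ^+ k.+1.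
Proof.
move=> a0 b0; elim: k => [|k ih]; first by rewrite !expr1 expr0 mulr1; lra.
have h1 := ler_wpM2l b0 ih.
have h2 : 0 <= k.+1%:R * a ^+ k * (b - a) ^+ 2.
  by rewrite mulr_ge0 ?sqr_ge0// mulr_ge0// exprn_ge0.
rewrite (exprS b k.+1) (le_trans _ h1)// -subr_ge0.
apply: le_trans h2 _; rewrite le_eqVlt; apply/orP; left; apply/eqP.
by rewrite !(exprS a) -[k.+2]addn1 natrD; ring.
Qed.

Lemma jensen_exprn (I : finType) (w b : I -> R) (k : nat) :
  (forall i, 0 <= w i) -> \sum_i w i = 1 -> (forall i, 0 <= b i) ->
  (\sum_i w i * b i) ^+ k <= \sum_i w i * b i ^+ k.
Proof.
move=> w0 w1 b0; case: k => [|k].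
  by rewrite expr0; under eq_bigr do rewrite expr0 mulr1; rewrite w1.
set a := \sum_i w i * b i.
have a0 : 0 <= a by apply: sumr_ge0 => i _; rewrite mulr_ge0.
rewrite (@le_trans _ _ (\sum_i w i * (a ^+ k.+1 + k.+1%:R * a ^+ k * (b i - a))))//.
  under eq_bigr do rewrite mulrDr mulrCA mulrBr.
  rewrite big_split/= -mulr_suml w1 mul1r -mulr_sumr sumrB -/a -mulr_suml w1.
  by rewrite mul1r subrr mulr0 addr0.
by apply: ler_sum => i _; rewrite ler_wpM2l// exprn_tangent.
Qed.

Lemma fact_le_expn n : (n`! <= n ^ n)%N.
Proof.
elim: n => // n ih; rewrite factS expnS leq_mul2l /=.
by apply: leq_trans ih _; case: n => // n; rewrite leq_exp2r.
Qed.

Lemma exprn_le_fact_expR (x : R) (n : nat) : 0 <= x ->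
  x ^+ n <= n`!%:R * expR x.
Proof.
move=> x0; case: n => [|n].
  by rewrite expr0 fact0 mul1r -[leLHS]expR0 ler_expR.
rewrite mulrC -ler_pdivrMr ?ltr0n ?fact_gt0//.
by rewrite (le_trans _ (expR_ge1Dxn n x0))// lerDr.
Qed.

(** The linear term is kept exact because it vanishes once a centred variable is integrated. The
    source is [exp t <= 1 + t exp t], used twice for [t >= 0] and combined with [1 - exp t <= - t]
    otherwise. *)
Lemma expR_le_quadratic (t : R) : expR t <= 1 + t + t ^+ 2 * expR `|t|.
Proof.
have h1 : expR t <= 1 + t * expR t.
  have : (1 - t) * expR t <= expR (- t) * expR t.
    by rewrite ler_wpM2r ?expR_ge0// expR_ge1Dx.
  by rewrite -expRD addNr expR0 mulrBl mul1r lerBlDr.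
have h2 := expR_ge1Dx t.
have [t0|t0] := leP 0 t.
  rewrite ger0_norm//.
  have : t * (expR t - 1) <= t * (t * expR t) by rewrite ler_wpM2l// lerBlDl.
  by rewrite expr2; move: h1; lra.
rewrite ltr0_norm//.
have h3 : - t * (1 - expR t) <= - t * - t.
  by rewrite ler_wpM2l; lra.
have h4 : t ^+ 2 <= t ^+ 2 * expR (- t).
  rewrite ler_peMr ?sqr_ge0// -expR0 ler_expR; lra.
by move: h1 h3 h4; rewrite expr2; lra.
Qed.

Lemma expR_le_mean (u v : R) : expR ((u + v) / 2) <= (expR u + expR v) / 2.
Proof.
have := sqr_ge0 (expR (u / 2) - expR (v / 2)).
rewrite sqrrB -!expRM_natl ![2%:R * _]mulrC !divfK ?pnatr_eq0// mulrDl expRD.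
lra.
Qed.

End real_inequalities.

(** * Independence as factorisation of integrals *)

Section independence.
Local Open Scope ereal_scope.
Context d (T : measurableType d) (R : realType) (P : probability T R).

Import HBNNSimple.

(** A product rule against events passes to simple functions by linearity and to [g] by monotone
    convergence. Taking [B = setT] shows that [c] is the integral of [h]; as a parameter it can be
    given directly as a product of integrals. *)
Lemma integral_mul_indep (h : T -> R) (xi : T -> R) (c : \bar R)
    (g : R -> R) :
  measurable_fun setT h -> (forall x, (0 <= h x)%R) -> measurable_fun setT xi ->
  0 <= c -> c \is a fin_num -> measurable_fun setT g -> (forall y, (0 <= g y)%R) ->
  (forall B, measurable B ->
    \int[P]_x ((h x)%:E * (\1_B (xi x))%:E) = c * P (xi @^-1` B)) ->
  \int[P]_x ((h x)%:E * (g (xi x))%:E) = c * \int[P]_x (g (xi x))%:E.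
Proof.
move=> mh h0 mxi c0 cfin mg g0 hB.
have mhE : measurable_fun setT (fun x => (h x)%:E) by exact/measurable_EFinP.
have hE x : 0 <= (h x)%:E by rewrite lee_fin.
have mxiB B : measurable B -> measurable (xi @^-1` B).
  by move=> mB; rewrite -[X in measurable X]setTI; exact: mxi.
have mG : measurable_fun setT (EFin \o g) by exact/measurable_EFinP.
have G0 y : setT y -> 0 <= (EFin \o g) y by rewrite lee_fin.
pose f_ := nnsfun_approx measurableT mG.
have mf n : measurable_fun setT (fun x => (f_ n (xi x))%:E).
  by apply/measurable_EFinP; apply: measurableT_comp.
have cf x : (fun n => (f_ n (xi x))%:E) @ \oo --> (g (xi x))%:E.
  exact: (@cvg_nnsfun_approx _ _ _ _ measurableT _ mG G0 (xi x)).
have nd x : nondecreasing_seq (fun n => (f_ n (xi x))%:E).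
  by move=> m n mn; rewrite lee_fin; exact/lefP/nd_nnsfun_approx.
have simple n : \int[P]_x ((h x)%:E * (f_ n (xi x))%:E) =
    c * \int[P]_x (f_ n (xi x))%:E.
  have fE y : (f_ n y)%:E =
      \sum_(k \in range (f_ n)) (k * \1_(f_ n @^-1` [set k]) y)%:E.
    by rewrite {1}fimfunE -fsumEFin.
  have mI k : measurable_fun setT (fun x => (\1_(f_ n @^-1` [set k]) (xi x))%:E : \bar R).
    by apply/measurable_EFinP; apply: measurableT_comp mxi; exact: measurable_indic.
  have kI k x : 0 <= (k * \1_(f_ n @^-1` [set k]) (xi x))%:E.
    exact: nnfun_muleindic_ge0.
  have mkI k : measurable_fun setT (fun x => (k * \1_(f_ n @^-1` [set k]) (xi x))%:E).
    by under eq_fun do rewrite EFinM; apply: measurable_funeM.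
  transitivity (\sum_(k \in range (f_ n))
      \int[P]_x ((h x)%:E * (k * \1_(f_ n @^-1` [set k]) (xi x))%:E)).
    rewrite -ge0_integral_fsum//; last 2 first.
    - by move=> k; apply: emeasurable_funM.
    - by move=> k x _; rewrite mule_ge0.
    by apply: eq_integral => x _; rewrite fE ge0_mule_fsumr.
  transitivity (c * \sum_(k \in range (f_ n))
      \int[P]_x (k * \1_(f_ n @^-1` [set k]) (xi x))%:E); last first.
    by rewrite -ge0_integral_fsum//; congr (c * _); apply: eq_integral => x _; rewrite fE.
  rewrite ge0_mule_fsumr; last by move=> k; exact: integral_ge0.
  apply: eq_fsbigr => k /[!inE] -[y _ <-{k}]; set k := f_ n y.
  have k0 : (0 <= k)%R by [].
  have mk : measurable (f_ n @^-1` [set k]) by [].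
  under eq_integral do rewrite EFinM muleCA.
  under [in RHS]eq_integral do rewrite EFinM.
  rewrite !ge0_integralZl//; last 2 first.
  - by apply: emeasurable_funM.
  - by move=> x _; rewrite mule_ge0// lee_fin.
  rewrite hB// muleCA; congr (c * (k%:E * _)).
  transitivity (\int[P]_x (\1_(xi @^-1` (f_ n @^-1` [set k])) x)%:E) => //.
  by rewrite integral_indic ?setIT//; exact: mxiB.
transitivity (\int[P]_x (limn (fun n => (h x)%:E * (f_ n (xi x))%:E))).
  apply: eq_integral => x _; apply/esym/cvg_lim => //.
  by apply: cvgeZl.
rewrite monotone_convergence//; last 3 first.
- by move=> n; apply: emeasurable_funM.
- by move=> n x _; rewrite mule_ge0// lee_fin.
- by move=> x _ m n mn; apply: lee_wpmul2l => //; exact: nd.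
under eq_fun do rewrite simple.
apply/cvg_lim => //; apply: cvgeZl => //.
under [X in _ --> X]eq_integral do rewrite -(cvg_lim _ (cf _))//.
by apply: cvg_monotone_convergence => // n x _; rewrite lee_fin.
Qed.

Lemma integral_prod_indep (m : nat) (xi : 'I_m -> T -> R) (g : 'I_m -> R -> R) :
  (forall i, measurable_fun setT (xi i)) ->
  (forall i, measurable_fun setT (g i)) -> (forall i y, (0 <= g i y)%R) ->
  (forall i, \int[P]_x (g i (xi i x))%:E < +oo) ->
  (forall C : 'I_m -> set R, (forall i, measurable (C i)) ->
    P (\bigcap_i (xi i @^-1` C i)) = \prod_i P (xi i @^-1` C i)) ->
  \int[P]_x (\prod_i g i (xi i x))%:E = \prod_i \int[P]_x (g i (xi i x))%:E.
Proof.
move=> mxi mg g0 gfin ind.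
have mI B : measurable B -> measurable_fun setT (\1_B : R -> R).
  by move=> mB; exact: measurable_indic.
(* the indicators of the product rule are replaced by the [g i] one at a time *)
pose F n (C : 'I_m -> set R) (i : 'I_m) : R -> R :=
  if (i < n)%N then g i else \1_(C i).
have mF n C i : measurable (C i) -> measurable_fun setT (F n C i).
  by move=> mC; rewrite /F; case: ifP => // _; exact: mI.
have F0 n C i y : (0 <= F n C i y)%R by rewrite /F; case: ifP.
have mFxi n C i : measurable (C i) ->
    measurable_fun setT (fun x => F n C i (xi i x)).
  by move=> mC; apply: measurableT_comp (mxi i); exact: mF.
have Pxi i B : measurable B -> \int[P]_x (\1_B (xi i x))%:E = P (xi i @^-1` B).
  move=> mB; transitivity (\int[P]_x (\1_(xi i @^-1` B) x)%:E) => //.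
  rewrite integral_indic ?setIT//.
  by rewrite -[X in measurable X]setTI; exact: mxi.
have Ffin n C i : measurable (C i) ->
    \int[P]_x (F n C i (xi i x))%:E \is a fin_num.
  move=> mC; rewrite ge0_fin_numE; last first.
    by apply: integral_ge0 => x _; rewrite lee_fin.
  rewrite /F; case: ifP => // _; rewrite Pxi// (le_lt_trans (probability_le1 P _))//.
    by rewrite -[X in measurable X]setTI; exact: mxi.
  by rewrite ltry.
(* The sets stay quantified in the induction: the step uses the hypothesis with an arbitrary [B] in
   slot [n], which is the product rule needed to put [g] there. *)
suff H n : (n <= m)%N -> forall C : 'I_m -> set R, (forall i, measurable (C i)) ->
    \int[P]_x (\prod_i F n C i (xi i x))%:E =
    \prod_i \int[P]_x (F n C i (xi i x))%:E.
  have := H m (leqnn m) (fun=> setT) (fun=> measurableT).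
  rewrite /F; under eq_integral do under eq_bigr do rewrite ltn_ord.
  by under [in RHS]eq_bigr do rewrite ltn_ord.
elim: n => [_ C mC|n ih nm C mC].
  under [RHS]eq_bigr do rewrite /F /= Pxi//.
  rewrite -ind// -[in RHS](setIT (\bigcap_i _)) -integral_indic//; last first.
    apply: fin_bigcap_measurable => // i _.
    by rewrite -[X in measurable X]setTI; exact: mxi.
  apply: eq_integral => x _; congr EFin; rewrite /F /=.
  rewrite indicE; case: (boolP (x \in _)) => [|/negP].
    by rewrite inE => xC; rewrite big1// => i _; rewrite indicE mem_set//; exact: xC.
  rewrite inE => /existsNP[i /not_implyP[_ xC]].
  by rewrite (bigD1 i)//= indicE memNset// mul0r.
pose i0 := Ordinal nm.
have FE D i : i != i0 -> F n.+1 D i = F n D i.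
  move=> ii0; rewrite /F ltnS leq_eqVlt.
  by case: eqP => // ni; case/eqP: ii0; exact: val_inj.
pose h x := (\prod_(i | i != i0) F n C i (xi i x))%R.
have step B : measurable B -> \int[P]_x ((h x)%:E * (\1_B (xi i0 x))%:E) =
    (\prod_(i | i != i0) \int[P]_x (F n C i (xi i x))%:E) * P (xi i0 @^-1` B).
  move=> mB; pose D i := if i == i0 then B else C i.
  have mD i : measurable (D i) by rewrite /D; case: ifP.
  have FD i : i != i0 -> F n D i = F n C i.
    by move=> /negbTE ii0; rewrite /F /D ii0.
  have FB : F n D i0 = \1_B by rewrite /F /D eqxx ltnn.
  have := ih (ltnW nm) D mD; rewrite [in RHS](bigD1 i0)//= FB Pxi//.
  under [in X in _ = _ * X -> _]eq_bigr do rewrite FD//.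
  rewrite [in RHS]muleC => <-; apply: eq_integral => x _.
  rewrite (bigD1 i0)//= FB mulrC EFinM; congr (_%:E * _).
  by apply: eq_bigr => i ii0; rewrite FD.
rewrite [in RHS](bigD1 i0)//=.
under [in X in _ = _ * X]eq_bigr do rewrite FE//.
have Fi0 : F n.+1 C i0 = g i0 by rewrite /F ltnSn.
rewrite Fi0 muleC -(@integral_mul_indep h)//.
- apply: eq_integral => x _; rewrite (bigD1 i0)//= Fi0 mulrC EFinM.
  by congr (_%:E * _); apply: eq_bigr => i ii0; rewrite FE.
- rewrite /h; under eq_fun do rewrite -big_filter.
  by apply: measurable_prod => i _; exact: mFxi.
- by move=> x; apply: prodr_ge0.
- by apply: prode_ge0 => i _; apply: integral_ge0 => x _; rewrite lee_fin.
- by apply: prode_fin_num => i _; exact: Ffin.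
Qed.

End independence.

(** * Even moments and tails of sums *)

Section concentration.
Context d (T : measurableType d) (R : realType) (P : probability T R).

(** [z^(2k) <= (2k)! exp |z|] is applied to [z = t S / L], and [exp |z| <= exp z + exp (- z)]
    accounts for the factor 2. The prefactor [(m / k)^k (2k)!] is at most [(4 k m)^k] because
    [n! <= n^n]. *)
Lemma moment_sum_indep (m k : nat) (xi : 'I_m -> T -> R) (L C : R) :
  (0 < k)%N -> (k <= m)%N -> 0 < L ->
  (forall i, measurable_fun setT (xi i)) ->
  (forall B : 'I_m -> set R, (forall i, measurable (B i)) ->
    P (\bigcap_i (xi i @^-1` B i)) = (\prod_i P (xi i @^-1` B i))%E) ->
  (forall i t, `|t| <= 1 ->
    (\int[P]_x (expR (t * (xi i x / L)))%:E <= (expR (C * t ^+ 2))%:E)%E) ->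
  (\int[P]_x (((\sum_i xi i x) / L) ^+ (2 * k))%:E <=
    (2 * (4 * k%:R * m%:R * expR C) ^+ k)%:E)%E.
Proof.
move=> k0 km L0 mxi ind mgf.
have m0 : (0 < m)%N by exact: leq_trans km.
pose S x := \sum_i xi i x.
have mS : measurable_fun setT S by apply: measurable_sum.
have mexp t : measurable_fun setT (fun x => expR (t * (S x / L))).
  apply: measurableT_comp => //; apply: measurable_funM => //.
  exact: measurable_funM.
have expS t : `|t| <= 1 ->
    (\int[P]_x (expR (t * (S x / L)))%:E <= (expR (m%:R * (C * t ^+ 2)))%:E)%E.
  move=> t1.
  have fin i : (\int[P]_x (expR (t * (xi i x / L)))%:E < +oo)%E.
    by rewrite (le_lt_trans (mgf i t t1))// ltry.
  rewrite (_ : (fun x => _) = (fun x => (\prod_i expR (t * (xi i x / L)))%:E)).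
    rewrite (@integral_prod_indep _ _ _ P m xi (fun i y => expR (t * (y / L))))//.
    - have int_ge0 i : (0 <= \int[P]_x (expR (t * (xi i x / L)))%:E)%E.
        by apply: integral_ge0 => x _; rewrite lee_fin expR_ge0.
      have fE i : (\int[P]_x (expR (t * (xi i x / L)))%:E =
          (fine (\int[P]_x (expR (t * (xi i x / L)))%:E))%:E)%E.
        by rewrite fineK// ge0_fin_numE.
      under eq_bigr do rewrite fE.
      rewrite prodEFin lee_fin expRM_natl -[X in _ ^+ X]card_ord -prodr_const.
      apply: ler_prod => i _; rewrite fine_ge0//=.
      by rewrite -lee_fin -fE mgf.
    - move=> i; apply: measurableT_comp => //; apply: measurable_funM => //.
      exact: measurable_funM.
  apply/funext => x; congr EFin.
  by rewrite -expR_sum /S mulr_suml mulr_sumr.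
(* At this [t] the bound [exp (m C t^2)] is [exp(C)^k], and [k <= m] keeps [t] in the interval where
   [mgf] holds. *)
pose t := Num.sqrt (k%:R / m%:R : R).
have t2 : t ^+ 2 = k%:R / m%:R by rewrite sqr_sqrtr.
have t0 : 0 < t by rewrite sqrtr_gt0 divr_gt0 ?ltr0n.
have t1 : `|t| <= 1.
  rewrite ger0_norm ?sqrtr_ge0// -sqrtr1 ler_sqrt//.
  by rewrite ler_pdivrMr ?ltr0n// mul1r ler_nat.
have expSt : (\int[P]_x (expR (t * (S x / L)))%:E <= (expR C ^+ k)%:E)%E.
  apply: le_trans (expS t t1) _; rewrite lee_fin -expRM_natl ler_expR t2.
  rewrite le_eqVlt; apply/orP; left; apply/eqP.
  by field; rewrite pnatr_eq0 -lt0n.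
have expSNt : (\int[P]_x (expR (- t * (S x / L)))%:E <= (expR C ^+ k)%:E)%E.
  apply: le_trans (expS (- t) _) _; first by rewrite normrN.
  rewrite sqrrN lee_fin -expRM_natl ler_expR t2.
  rewrite le_eqVlt; apply/orP; left; apply/eqP.
  by field; rewrite pnatr_eq0 -lt0n.
pose c : R := (m%:R / k%:R) ^+ k * (2 * k)`!%:R.
have c0 : 0 <= c by rewrite mulr_ge0// exprn_ge0.
have pw x : (S x / L) ^+ (2 * k) <=
    c * (expR (t * (S x / L)) + expR (- t * (S x / L))).
  set z := S x / L.
  have := @exprn_le_fact_expR R `|t * z| (2 * k) (normr_ge0 _).
  have -> : `|t * z| ^+ (2 * k) = (k%:R / m%:R) ^+ k * z ^+ (2 * k).
    rewrite [LHS]exprM real_normK ?num_real// [(t * z) ^+ 2]exprMn t2.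
    by rewrite [LHS]exprMn -exprM.
  have : expR `|t * z| <= expR (t * z) + expR (- t * z).
    case: (ger0P (t * z)) => _; first by rewrite lerDl expR_ge0.
    by rewrite mulNr lerDr expR_ge0.
  move=> h1 h2; rewrite /c -mulrA -ler_pdivrMl; last first.
    by rewrite exprn_gt0// divr_gt0 ?ltr0n.
  rewrite -exprVn invf_div (le_trans h2)// ler_wpM2l//.
have c_le : c <= (4 * k%:R * m%:R) ^+ k.
  have f_le : (2 * k)`!%:R <= (4 * k%:R ^+ 2) ^+ k :> R.
    rewrite (_ : (4 * k%:R ^+ 2) ^+ k = ((2 * k) ^ (2 * k))%:R) ?ler_nat ?fact_le_expn//.
    by rewrite natrX exprM natrM; congr (_ ^+ _); ring.
  rewrite /c (le_trans (ler_wpM2l _ f_le)) ?exprn_ge0//.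
  rewrite -exprMn (_ : m%:R / k%:R * (4 * k%:R ^+ 2) = 4 * k%:R * m%:R)//.
  by field; rewrite pnatr_eq0 -lt0n.
have int_ge0 u : (0 <= \int[P]_x (expR (u * (S x / L)))%:E)%E.
  by apply: integral_ge0 => x _; rewrite lee_fin expR_ge0.
apply: (@le_trans _ _ (\int[P]_x
    (c%:E * ((expR (t * (S x / L)))%:E + (expR (- t * (S x / L)))%:E))))%E.
  apply: ge0_le_integral => //.
  - by move=> x _; rewrite lee_fin exprM exprn_ge0// sqr_ge0.
  - apply/measurable_EFinP; apply: measurable_funX; exact: measurable_funM.
  - by apply: measurable_funeM; apply: emeasurable_funD; exact/measurable_EFinP.
  - by move=> x _; rewrite -EFinD -EFinM lee_fin; exact: pw.
rewrite ge0_integralZl_EFin//; last 2 first.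
  by move=> x _; rewrite adde_ge0// lee_fin expR_ge0.
  by apply: emeasurable_funD; exact/measurable_EFinP.
rewrite ge0_integralD//; last 2 first.
  exact/measurable_EFinP.
  exact/measurable_EFinP.
apply: (@le_trans _ _ (c%:E * ((expR C ^+ k)%:E + (expR C ^+ k)%:E)))%E.
  by rewrite lee_wpmul2l ?lee_fin// leeD.
rewrite -EFinD -EFinM lee_fin exprMn.
have e0 : 0 <= expR C ^+ k by rewrite exprn_ge0 ?expR_ge0.
by have := ler_wpM2r e0 c_le; lra.
Qed.

(** Convexity replaces a union bound over [j], so the estimate sees [I] only through [Lam] and
    remains uniform as the truncation grows. The extra 1 in [expR (C + 1)] is the factor [e] which
    Markov's inequality, raised to the power [k], turns into [exp (- k)]. *)
Lemma sum_squares_tail (I : finType) (m k : nat) (xi : I -> 'I_m -> T -> R)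
    (L : I -> R) (C Lam : R) :
  (0 < k)%N -> (k <= m)%N -> (forall j, 0 < L j) -> 0 < Lam ->
  \sum_j L j ^+ 2 <= Lam ->
  (forall j i, measurable_fun setT (xi j i)) ->
  (forall j (B : 'I_m -> set R), (forall i, measurable (B i)) ->
    P (\bigcap_i (xi j i @^-1` B i)) = (\prod_i P (xi j i @^-1` B i))%E) ->
  (forall j i t, `|t| <= 1 ->
    (\int[P]_x (expR (t * (xi j i x / L j)))%:E <= (expR (C * t ^+ 2))%:E)%E) ->
  (P [set x | (4 * k%:R * m%:R * expR (C + 1) * Lam <
              \sum_j (\sum_i xi j i x) ^+ 2)%R]
   <= (2 * expR (- k%:R))%:E)%E.
Proof.
move=> k0 km L0 Lam0 LLam mxi ind mgf.
pose D := \sum_j L j ^+ 2.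
pose V x := \sum_j (\sum_i xi j i x) ^+ 2.
have mV : measurable_fun setT V.
  apply: measurable_sum => j; apply: measurable_funX.
  by apply: measurable_sum.
pose w := fun j => L j ^+ 2 / D.
have m0 : (0 < m)%N by exact: leq_trans km.
have s0 : 0 < 4 * k%:R * m%:R * expR (C + 1) * Lam :> R.
  by rewrite !mulr_gt0 ?ltr0n ?expR_gt0.
set s := _ * Lam in s0 *.
(* For empty [I] the weights would have denominator [D = 0]; the sum of squares is then zero. The
   truncation at [n = 0] is such a case. *)
have [I0|/existsNP[j0 _]] := pselect (forall j : I, False).
  rewrite (_ : [set _ | _] = set0) ?measure0 ?lee_fin ?mulr_ge0 ?expR_ge0//.
  apply/seteqP; split=> // x /=; rewrite big1; last by move=> j; have := I0 j.
  by rewrite ltNge (ltW s0).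
have D0 : 0 < D.
  rewrite /D (bigD1 j0)//= ltr_wpDr ?exprn_gt0//.
  by apply: sumr_ge0 => j _; rewrite sqr_ge0.
have w0 j : 0 <= w j by rewrite /w divr_ge0 ?sqr_ge0// ltW.
have w1 : \sum_j w j = 1 by rewrite /w -mulr_suml divff// gt_eqF.
have VE x : V x / D = \sum_j w j * ((\sum_i xi j i x) / L j) ^+ 2.
  rewrite /V mulr_suml; apply: eq_bigr => j _; rewrite /w.
  by field; rewrite !gt_eqF.
have Vk x : (V x / D) ^+ k <=
    \sum_j w j * ((\sum_i xi j i x) / L j) ^+ (2 * k).
  rewrite VE; under [leRHS]eq_bigr do rewrite exprM.
  by apply: jensen_exprn => // j; rewrite sqr_ge0.
have intV : (\int[P]_x ((V x / D) ^+ k)%:E <=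
    (2 * (4 * k%:R * m%:R * expR C) ^+ k)%:E)%E.
  have mz j : measurable_fun setT
      (fun x => ((\sum_i xi j i x) / L j) ^+ (2 * k)).
    apply: measurable_funX; apply: measurable_funM => //.
    by apply: measurable_sum.
  have z0 j x : 0 <= ((\sum_i xi j i x) / L j) ^+ (2 * k).
    by rewrite exprM exprn_ge0// sqr_ge0.
  apply: (@le_trans _ _ (\int[P]_x
     (\sum_j (w j)%:E * (((\sum_i xi j i x) / L j) ^+ (2 * k))%:E)))%E.
    apply: ge0_le_integral => //.
    - move=> x _; rewrite lee_fin exprn_ge0// divr_ge0 ?(ltW D0)//.
      by apply: sumr_ge0 => j _; rewrite sqr_ge0.
    - apply/measurable_EFinP; apply: measurable_funX; exact: measurable_funM.
    - apply: emeasurable_sum => j; apply: measurable_funeM.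
      exact/measurable_EFinP.
    - move=> x _; under [leRHS]eq_bigr do rewrite -EFinM.
      by rewrite sumEFin lee_fin.
  rewrite ge0_integral_sum//; last 2 first.
  - by move=> j; apply: measurable_funeM; exact/measurable_EFinP.
  - by move=> j x _; rewrite mule_ge0// lee_fin.
  apply: (@le_trans _ _ (\sum_j
      (w j)%:E * (2 * (4 * k%:R * m%:R * expR C) ^+ k)%:E))%E.
    apply: lee_sum => j _; rewrite ge0_integralZl_EFin//; last 2 first.
    - by move=> x _; rewrite lee_fin.
    - exact/measurable_EFinP.
    apply: lee_wpmul2l; first by rewrite lee_fin.
    by apply: moment_sum_indep => //; [exact: ind|exact: mgf].
  under eq_bigr do rewrite -EFinM.
  by rewrite sumEFin -mulr_suml w1 mul1r.
have mA : measurable [set x | s < V x].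
  by have := mV measurableT _ (measurable_itv `]s, +oo[); rewrite setTI set_itvoy.
pose r := (s / D) ^+ k.
have r0 : 0 < r by rewrite exprn_gt0// divr_gt0.
have markov : (r%:E * P [set x | (s < V x)%R] <= \int[P]_x ((V x / D) ^+ k)%:E)%E.
  rewrite -[X in P X]setIT -integral_indic// -ge0_integralZl_EFin//; last 2 first.
  - by apply/measurable_EFinP; exact: measurable_indic.
  - exact: (ltW r0).
  apply: ge0_le_integral => //.
  - by move=> x _; rewrite mule_ge0// lee_fin// ltW.
  - by apply: measurable_funeM; exact/measurable_EFinP.
  - by apply/measurable_EFinP; apply: measurable_funX; exact: measurable_funM.
  - move=> x _; rewrite -EFinM lee_fin indicE.
    have V0 : 0 <= V x by apply: sumr_ge0 => j _; rewrite sqr_ge0.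
    case: (boolP (x \in _)) => [|_].
      rewrite inE /= => sV; rewrite mulr1 /r ler_pXn2r ?nnegrE ?divr_ge0 ?(ltW s0) ?(ltW D0)//.
      by rewrite ler_pM2r ?invr_gt0// ltW.
    by rewrite mulr0 exprn_ge0// divr_ge0// ltW.
have := le_trans markov intV.
rewrite -[P _]fineK ?fin_num_measure// -EFinM !lee_fin => h.
rewrite -(ler_pM2l r0) (le_trans h)//.
have -> : r * (2 * expR (- k%:R)) = 2 * (s / D * expR (-1)) ^+ k.
  by rewrite exprMn -expRM_natl mulrN1 mulrCA.
have E : s / D * expR (-1) = 4 * k%:R * m%:R * expR C * (Lam / D).
  rewrite /s expRD expRN; field.
  by rewrite !gt_eqF ?expR_gt0.
have h0 : 0 <= 4 * k%:R * m%:R * expR C by rewrite !mulr_ge0// expR_ge0.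
have h1 : 4 * k%:R * m%:R * expR C <= s / D * expR (-1).
  by rewrite E ler_peMr// ler_pdivlMr// mul1r.
by rewrite ler_pM2l// lerXn2r ?nnegrE// (le_trans h0).
Qed.

End concentration.

(** * Exponential moments and random vectors *)

Section exponential_moments.
Context d (T : measurableType d) (R : realType) (P : probability T R).

Lemma integral_probability_cst (c : \bar R) : (\int[P]_w (cst c) w = c)%E.
Proof.
rewrite integral_cst// -[RHS]mule1; congr (_ * _)%E.
exact: probability_setT.
Qed.

Lemma expR_nneseries (y : R) :
  (expR y)%:E = (\sum_(k <oo) (y ^+ k / k`!%:R)%:E)%E.
Proof.
apply/esym/cvg_lim => //.
rewrite (_ : (fun n => _) = EFin \o (series (exp_coeff y))); last first.
  by apply/funext => n; rewrite /= sumEFin.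
by move/cvg_comp : (is_cvg_series_exp_coeff y); apply.
Qed.

(** The sub-Gaussian bound at [p = 2k], raised to the power [2k]. Finiteness of the second moment
    rules out infinite norms. *)
Lemma subgaussian_moment (a : T -> R) (kappa q : R) (k : nat) :
  (0 < k)%N ->
  (forall p : R, 1 < p -> ('N[P]_(p%:E)[(fun w => (a w)%:E)] <=
     (kappa * Num.sqrt p)%:E * 'N[P]_(2%:E)[(fun w => (a w)%:E)])%E) ->
  (\int[P]_w (a w ^+ 2)%:E = q%:E)%E ->
  (\int[P]_w (a w ^+ (2 * k))%:E <= ((kappa ^+ 2 * (2 * k)%:R * q) ^+ k)%:E)%E.
Proof.
move=> k0 sg aq.
have pE n : (0 < n)%N ->
    (('N[P]_((2 * n)%:R%:E)[(fun w => (a w)%:E)]) `^ ((2 * n)%:R : R) =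
     \int[P]_w (a w ^+ (2 * n))%:E)%E.
  move=> n0; rewrite powR_Lnorm ?pnatr_eq0 -?lt0n ?muln_gt0//.
  apply: eq_integral => w _ /=.
  by rewrite powR_mulrn// -normrX exprM ger0_norm// exprn_ge0// sqr_ge0.
have N2 := pE 1%N isT; rewrite muln1 aq in N2.
have N2_ge0 := Lnorm_ge0 P 2%:E (fun w => (a w)%:E).
have := sg (2 * k)%:R; rewrite ltr1n -[1%N]/(0.+1) => /(_ _)/wrap[].
  by case: (k) k0 => // -[].
have := pE k k0; have := Lnorm_ge0 P (2 * k)%:R%:E (fun w => (a w)%:E).
move: N2 N2_ge0; set n2 := Lnorm P 2%:E _; set n := Lnorm P _ _.
case: n2 => [r2| |] //; last by rewrite poweRyr ?pnatr_eq0.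
rewrite poweR_EFin lee_fin => -[r2q] r20.
case: n => [r| |]//; rewrite poweR_EFin lee_fin => r0 <-.
rewrite -EFinM lee_fin => rle; rewrite lee_fin.
rewrite powR_mulrn// in r2q *.
rewrite powR_mulrn//.
rewrite (le_trans (lerXn2r _ _ _ rle)) ?nnegrE// ?(le_trans r0)//.
rewrite exprM (_ : (_ * r2) ^+ 2 = kappa ^+ 2 * (2 * k)%:R * q)//.
by rewrite 2!exprMn sqr_sqrtr// r2q.
Qed.

(** Termwise in the exponential series: [k^k <= k! e^k] bounds the [k]-th term by
    [(2 e kappa^2 q / s)^k]. The constant 4 in the condition on [s] makes the ratio at most 1/2, and
    the geometric sum 2 is below [e]. *)
Lemma subgaussian_expR (a : T -> R) (kappa q s : R) :
  measurable_fun setT a ->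
  (forall p : R, 1 < p -> ('N[P]_(p%:E)[(fun w => (a w)%:E)] <=
     (kappa * Num.sqrt p)%:E * 'N[P]_(2%:E)[(fun w => (a w)%:E)])%E) ->
  (\int[P]_w (a w ^+ 2)%:E = q%:E)%E ->
  0 < s -> 4 * expR 1 * kappa ^+ 2 * q <= s ->
  (\int[P]_w (expR (a w ^+ 2 / s))%:E <= (expR 1)%:E)%E.
Proof.
move=> ma sg aq s0 qs.
have q0 : 0 <= q.
  by rewrite -lee_fin -aq; apply: integral_ge0 => w _; rewrite lee_fin sqr_ge0.
pose z w := a w ^+ 2 / s.
have z0 w : 0 <= z w by rewrite divr_ge0 ?sqr_ge0 ?ltW.
have zk0 k w : 0 <= z w ^+ k / k`!%:R by rewrite divr_ge0 ?exprn_ge0.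
have mz k : measurable_fun setT (fun w => z w ^+ k / k`!%:R).
  apply: measurable_funM => //; apply: measurable_funX.
  by apply: measurable_funM => //; exact: measurable_funX.
under eq_integral do rewrite expR_nneseries.
rewrite integral_nneseries//; last 2 first.
- by move=> k; apply/measurable_EFinP; exact: mz.
- by move=> k w _; rewrite lee_fin; exact: zk0.
have term k : (\int[P]_w (z w ^+ k / k`!%:R)%:E <= (2^-1 ^+ k)%:E)%E.
  case: k => [|k].
    under eq_integral do rewrite !expr0 fact0 divr1.
    by rewrite expr0 integral_cst// mul1e; exact: probability_le1.
  set n := k.+1; pose c := (s ^+ n * n`!%:R)^-1.
  have c0 : 0 <= c by rewrite invr_ge0 mulr_ge0// exprn_ge0// ltW.
  have -> : (fun w => (z w ^+ n / n`!%:R)%:E) =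
      (fun w => c%:E * (a w ^+ (2 * n))%:E)%E.
    apply/funext => w; rewrite -EFinM /c /z exprM expr_div_n; congr EFin.
    by rewrite invfM; ring.
  rewrite ge0_integralZl_EFin//; last 2 first.
  - by move=> w _; rewrite lee_fin exprM exprn_ge0// sqr_ge0.
  - by apply/measurable_EFinP; exact: measurable_funX.
  apply: (@le_trans _ _ (c%:E * ((kappa ^+ 2 * (2 * n)%:R * q) ^+ n)%:E)%E).
    by apply: lee_wpmul2l; [rewrite lee_fin|exact: subgaussian_moment].
  rewrite -EFinM lee_fin.
  have e0 : 0 < expR 1 :> R := expR_gt0 _.
  have h1 : (n%:R : R) ^+ n <= n`!%:R * expR 1 ^+ n.
    by rewrite -expRM_natl mulr1; exact: exprn_le_fact_expR.
  have h2 : (2 * kappa ^+ 2 * q) ^+ n <= (2^-1 * (s / expR 1)) ^+ n.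
    rewrite lerXn2r ?nnegrE//.
    - by rewrite mulr_ge0// mulr_ge0// sqr_ge0.
    - by rewrite mulr_ge0// divr_ge0// ltW.
    rewrite -(ler_pM2r e0) -[leRHS]mulrA divfK ?gt_eqF//; move: qs.
    by set u := expR 1; lra.
  rewrite /c -(ler_pM2l (x := s ^+ n * n`!%:R)); last first.
    by rewrite mulr_gt0 ?exprn_gt0 ?ltr0n ?fact_gt0.
  rewrite mulrA divff ?mul1r; last first.
    by rewrite gt_eqF// mulr_gt0 ?exprn_gt0 ?ltr0n ?fact_gt0.
  have -> : kappa ^+ 2 * (2 * n)%:R * q = (2 * kappa ^+ 2 * q) * n%:R.
    by rewrite natrM; ring.
  rewrite exprMn (le_trans (ler_pM _ _ h2 h1)) ?exprn_ge0//.
    by rewrite mulr_ge0// mulr_ge0// sqr_ge0.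
  rewrite !exprMn !exprVn; set u := expR 1 ^+ n.
  rewrite le_eqVlt; apply/orP; left; apply/eqP.
  by field; rewrite !gt_eqF// exprn_gt0.
apply: lime_le.
  apply: is_cvg_nneseries => k _ _; apply: integral_ge0 => w _.
  by rewrite lee_fin; exact: zk0.
apply: nearW => n.
have geo : \sum_(0 <= k < n) 2^-1 ^+ k <= 2 - 2 * 2^-1 ^+ n :> R.
  elim: n => [|n ih]; first by rewrite big_geq// expr0; lra.
  rewrite big_nat_recr//= exprS; move: ih; set u := \sum_(_ <= _ < _) _.
  by lra.
apply: (@le_trans _ _ (\sum_(0 <= k < n) (2^-1 ^+ k)%:E)%E).
  by apply: lee_sum => k _; exact: term.
rewrite sumEFin lee_fin (le_trans geo)//.
have := expR_ge1Dx (1 : R).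
have : 0 <= 2^-1 ^+ n :> R by rewrite exprn_ge0.
lra.
Qed.

(** The quadratic term of the exponential is at most [theta^2 y^2 exp |y|], hence
    [2 theta^2 exp (2 |y|)]. The 2 in the scale [2 sqrt (s t)] makes [2 |y|] at most the mean of
    [a^2 / s] and [b^2 / t] plus the centring cost [e], so only the two assumed exponential moments
    occur, and [exp (exp 1)] is the price of centring. *)
Lemma centered_product_mgf (a b : T -> R) (s t c theta : R) :
  measurable_fun setT a -> measurable_fun setT b -> 0 < s -> 0 < t ->
  (\int[P]_w (expR (a w ^+ 2 / s))%:E <= (expR 1)%:E)%E ->
  (\int[P]_w (expR (b w ^+ 2 / t))%:E <= (expR 1)%:E)%E ->
  (\int[P]_w (a w * b w)%:E = c%:E)%E -> `|theta| <= 1 ->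
  (\int[P]_w (expR (theta * ((a w * b w - c) / (2 * Num.sqrt (s * t)))))%:E
   <= (expR (2 * expR (1 + expR 1) * theta ^+ 2))%:E)%E.
Proof.
move=> ma mb s0 t0 ea eb abc th1.
set L := 2 * Num.sqrt (s * t).
have st0 : 0 < Num.sqrt (s * t) by rewrite sqrtr_gt0 mulr_gt0.
have L0 : 0 < L by rewrite mulr_gt0.
pose ua w := a w ^+ 2 / s; pose ub w := b w ^+ 2 / t.
pose z w := (a w * b w - c) / L.
have mua : measurable_fun setT ua.
  by apply: measurable_funM => //; exact: measurable_funX.
have mub : measurable_fun setT ub.
  by apply: measurable_funM => //; exact: measurable_funX.
have mz : measurable_fun setT z.
  apply: measurable_funM => //; apply: measurable_funB => //.
  exact: measurable_funM.
have ua0 w : 0 <= ua w by rewrite divr_ge0 ?sqr_ge0 ?ltW.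
have ub0 w : 0 <= ub w by rewrite divr_ge0 ?sqr_ge0 ?ltW.
(* AM-GM: [|a b| / sqrt (s t) <= (a^2 / s + b^2 / t) / 2] *)
have amgm w : `|a w * b w| / L <= (ua w + ub w) / 4.
  have ss0 : 0 < Num.sqrt s by rewrite sqrtr_gt0.
  have tt0 : 0 < Num.sqrt t by rewrite sqrtr_gt0.
  have uaE : ua w = (`|a w| / Num.sqrt s) ^+ 2.
    by rewrite /ua expr_div_n sqr_sqrtr ?(ltW s0)// real_normK ?num_real.
  have ubE : ub w = (`|b w| / Num.sqrt t) ^+ 2.
    by rewrite /ub expr_div_n sqr_sqrtr ?(ltW t0)// real_normK ?num_real.
  have -> : `|a w * b w| / L =
      2^-1 * ((`|a w| / Num.sqrt s) * (`|b w| / Num.sqrt t)).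
    rewrite /L normrM sqrtrM ?(ltW s0)//; field.
    by rewrite !gt_eqF.
  rewrite uaE ubE; move: (`|a w| / _) (`|b w| / _) => x y.
  by have := sqr_ge0 (x - y); rewrite sqrrB; lra.
pose ea' w := expR (ua w); pose eb' w := expR (ub w).
have mea : measurable_fun setT ea' by exact: measurableT_comp.
have meb : measurable_fun setT eb' by exact: measurableT_comp.
have ea0 w : 0 <= ea' w := expR_ge0 _.
have eb0 w : 0 <= eb' w := expR_ge0 _.
have eaE w : (0 <= (ea' w)%:E)%E by rewrite lee_fin.
have ebE w : (0 <= (eb' w)%:E)%E by rewrite lee_fin.
have meaE : measurable_fun setT (fun w => (ea' w)%:E) by exact/measurable_EFinP.
have mebE : measurable_fun setT (fun w => (eb' w)%:E) by exact/measurable_EFinP.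
have iea : P.-integrable setT (EFin \o ea').
  apply/integrableP; split; first exact/measurable_EFinP.
  under eq_integral do rewrite /= ger0_norm//.
  by rewrite (le_lt_trans ea)// ltry.
have ieb : P.-integrable setT (EFin \o eb').
  apply/integrableP; split; first exact/measurable_EFinP.
  under eq_integral do rewrite /= ger0_norm//.
  by rewrite (le_lt_trans eb)// ltry.
have lt_exp (x : R) : x <= expR x by have := expR_ge1Dx x; lra.
have mab : measurable_fun setT (fun w => a w * b w) by exact: measurable_funM.
have abL w : `|a w * b w| <= L / 4 * (ea' w + eb' w).
  have := amgm w; rewrite ler_pdivrMr// => h.
  have -> : L / 4 * (ea' w + eb' w) = (ea' w + eb' w) / 4 * L by ring.
  by rewrite (le_trans h)// !ler_pM2r ?invr_gt0// lerD// lt_exp.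
have iab : P.-integrable setT (fun w => (a w * b w)%:E).
  apply: (@le_integrable _ _ _ P setT measurableT _
     (fun w => (L / 4)%:E * ((ea' w)%:E + (eb' w)%:E))%E).
  - exact/measurable_EFinP.
  - move=> w _; rewrite -EFinD -EFinM !abse_EFin lee_fin (le_trans (abL w))//.
    exact: ler_norm.
  - by apply: integrableZl => //; exact: integrableD.
have c_le : `|c| / L <= expR 1 / 2.
  rewrite ler_pdivrMr// -lee_fin -abse_EFin -abc.
  rewrite (le_trans (le_abse_integral _ _ _))//; first exact/measurable_EFinP.
  apply: (@le_trans _ _ (\int[P]_w
     ((L / 4)%:E * ((ea' w)%:E + (eb' w)%:E))))%E.
    apply: ge0_le_integral => //.
    - by apply/measurable_EFinP; apply: measurableT_comp.
    - by apply: measurable_funeM; apply: emeasurable_funD; exact/measurable_EFinP.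
    - by move=> w _; rewrite -EFinD -EFinM lee_fin.
  rewrite ge0_integralZl_EFin//; last 3 first.
  - by move=> w _; rewrite adde_ge0// lee_fin.
  - by apply: emeasurable_funD; exact/measurable_EFinP.
  - by rewrite divr_ge0// ltW.
  rewrite ge0_integralD//.
  apply: (@le_trans _ _ ((L / 4)%:E * ((expR 1)%:E + (expR 1)%:E))%E).
    by apply: lee_wpmul2l; [rewrite lee_fin divr_ge0// ltW|exact: leeD].
  by rewrite -EFinD -EFinM lee_fin; lra.
have z_le w : 2 * `|z w| <= (ua w + ub w) / 2 + expR 1.
  have : `|z w| <= `|a w * b w| / L + `|c| / L.
    by rewrite /z normrM normfV (gtr0_norm L0) -mulrDl ler_pM2r ?invr_gt0// ler_normB.
  by have := amgm w; move: c_le; lra.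
pose K := expR (expR 1 : R).
have pw w : expR (theta * z w) <= 1 + theta * z w + theta ^+ 2 * K * (ea' w + eb' w).
  move: (z_le w); move: (z w) => y y_le.
  apply: le_trans (expR_le_quadratic _) _; rewrite lerD2l exprMn.
  rewrite -[leLHS]mulrA -[leRHS]mulrA ler_wpM2l ?sqr_ge0//.
  have h1 : `|theta * y| <= `|y| by rewrite normrM ler_piMl.
  have h2 : y ^+ 2 <= 2 * expR `|y|.
    by have := @exprn_le_fact_expR R `|y| 2 (normr_ge0 _); rewrite real_normK ?num_real.
  apply: (@le_trans _ _ (2 * expR `|y| * expR `|y|)).
    by rewrite ler_pM ?sqr_ge0 ?expR_ge0// ler_expR.
  rewrite -mulrA -expRD -mulr2n -[X in expR X]mulr_natl.
  apply: (@le_trans _ _ (2 * expR ((ua w + ub w) / 2 + expR 1))).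
    by rewrite ler_pM2l// ler_expR.
  rewrite expRD -/K mulrCA mulrC -mulrA mulrC -mulrA ler_wpM2l ?expR_ge0//.
  by have := expR_le_mean (ua w) (ub w); rewrite /ea' /eb'; lra.
have iz : P.-integrable setT (EFin \o z).
  have -> : EFin \o z = (fun w => (L^-1)%:E * ((a w * b w)%:E - (cst c%:E) w))%E.
    by apply/funext => w /=; rewrite -EFinB -EFinM mulrC.
  apply: integrableZl => //; apply: integrableB => //.
  exact: finite_measure_integrable_cst.
have z_mean : (\int[P]_w (z w)%:E = 0)%E.
  have -> : (fun w => (z w)%:E) = (fun w => (L^-1)%:E * ((a w * b w)%:E - (cst c%:E) w))%E.
    by apply/funext => w /=; rewrite -EFinB -EFinM mulrC.
  have icst : P.-integrable setT (cst c%:E : T -> \bar R).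
    exact: finite_measure_integrable_cst.
  rewrite integralZl//; last exact: integrableB.
  rewrite integralB// abc integral_probability_cst.
  by rewrite subee// mule0.
have ih : P.-integrable setT (fun w => (theta ^+ 2 * K)%:E * ((ea' w)%:E + (eb' w)%:E))%E.
  by apply: integrableZl => //; exact: integrableD.
have i1z : P.-integrable setT (fun w => (cst 1%E) w + theta%:E * (z w)%:E)%E.
  apply: integrableD => //; last exact: integrableZl.
  exact: finite_measure_integrable_cst.
apply: (@le_trans _ _ (\int[P]_w (((cst 1%E) w + theta%:E * (z w)%:E) +
     (theta ^+ 2 * K)%:E * ((ea' w)%:E + (eb' w)%:E))))%E.
  apply: ge0_le_integral => //.
  - by apply/measurable_EFinP; apply: measurableT_comp => //; exact: measurable_funM.
  - apply: emeasurable_funD; [apply: emeasurable_funD => // |].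
      by apply: measurable_funeM; exact/measurable_EFinP.
    by apply: measurable_funeM; apply: emeasurable_funD; exact/measurable_EFinP.
  - by move=> w _; rewrite -!(EFinD, EFinM) lee_fin; exact: pw.
rewrite integralD// integralD//; last 2 first.
- exact: finite_measure_integrable_cst.
- exact: integrableZl.
rewrite integral_probability_cst integralZl// z_mean mule0 adde0.
rewrite ge0_integralZl_EFin//; last 3 first.
- by move=> w _; rewrite adde_ge0// lee_fin.
- by apply: emeasurable_funD; exact/measurable_EFinP.
- by rewrite mulr_ge0 ?sqr_ge0 ?expR_ge0.
rewrite ge0_integralD//.
apply: (@le_trans _ _ (1 + (theta ^+ 2 * K)%:E * ((expR 1)%:E + (expR 1)%:E))%E).
  rewrite leeD2l//; apply: lee_wpmul2l; last exact: leeD.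
  by rewrite lee_fin mulr_ge0 ?sqr_ge0 ?expR_ge0.
rewrite -(EFinD (expR 1)) -EFinM -(EFinD 1) lee_fin.
apply: le_trans (expR_ge1Dx _).
rewrite expRD -/K; set u := expR 1; set v := theta ^+ 2; lra.
Qed.

End exponential_moments.

(** * Laws, Borel sets and weakly measurable vectors *)

Section random_vectors.
Context {R : realType}.

Lemma eq_law_integral d d' (T : measurableType d) (T' : measurableType d')
    (P : probability T R) (Q : probability T' R) (u : T -> R) (v : T' -> R)
    (g : R -> R) :
  measurable_fun setT u -> measurable_fun setT v -> measurable_fun setT g ->
  (forall y, 0 <= g y) ->
  (forall B, measurable B -> Q (v @^-1` B) = P (u @^-1` B)) ->
  (\int[Q]_w (g (v w))%:E = \int[P]_w (g (u w))%:E)%E.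
Proof.
move=> mu mv mg g0 uv.
have mgE : measurable_fun setT (EFin \o g) by exact/measurable_EFinP.
have gE y : y \in [set: R] -> (0 <= (EFin \o g) y)%E by rewrite lee_fin.
have := @ge0_integral_pushforward _ _ _ _ R u mu P setT _ measurableT mgE gE.
have := @ge0_integral_pushforward _ _ _ _ R v mv Q setT _ measurableT mgE gE.
rewrite !preimage_setT => <- <-.
apply: eq_measure_integral => B mB _; exact: uv.
Qed.

Lemma borel_preimage (T U : topologicalType) (f : T -> U) (B : set U) :
  continuous f -> borel B -> borel (f @^-1` B).
Proof.
move=> /continuousP cf; have [s0 sC sU] := smallest_sigma_algebra setT (@open T).
suff H : @borel U `<=` [set C | borel (f @^-1` C)] by exact: H.
apply: smallest_sub => [|C oC]; last by apply: sub_sigma_algebra; exact: cf.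
split => /= [|C bC|F bF].
- by rewrite preimage_set0.
- by rewrite setTD -preimage_setC -setTD; exact: sC.
- by rewrite preimage_bigcup; exact: sU.
Qed.

Lemma measurable_borel (B : set R) : measurable B -> borel B.
Proof.
rewrite [X in X -> _](_ : _ = (RGenOpens.G (R := R)).-sigma.-measurable B).
  apply: smallest_sub; first exact: smallest_sigma_algebra.
  move=> _ [a [b ->]]; apply: sub_sigma_algebra; exact: itv_open.
by rewrite -RGenOpens.measurableE.
Qed.

Lemma random_vector_comp d (Om : measurableType d) (T U : topologicalType)
    (f : T -> U) (x : Om -> T) :
  continuous f -> random_vector x -> random_vector (f \o x).
Proof. by move=> cf rx B bB; exact: (rx _ (borel_preimage cf bB)). Qed.

Lemma random_vector_measurable d (Om : measurableType d) (x : Om -> R) :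
  random_vector x -> measurable_fun setT x.
Proof. by move=> rx _ B mB; rewrite setTI; apply: rx; exact: measurable_borel. Qed.

Section hilbert_valued.
Context (X : hilbertType R) (e : nat -> X).
Hypothesis parseval : forall u,
  (\sum_(0 <= j < n) inner u (e j) ^+ 2) @[n --> \oo] --> `|u| ^+ 2.

Lemma parseval_le u n : \sum_(0 <= j < n) inner u (e j) ^+ 2 <= `|u| ^+ 2.
Proof.
rewrite -(cvg_lim _ (@parseval u))//; apply: nondecreasing_cvgn_le.
  by apply/nondecreasing_seqP => k; rewrite big_nat_recr//= lerDl sqr_ge0.
by apply/cvg_ex; eexists; exact: (@parseval u).
Qed.

Lemma parseval_ge u C :
  (forall n, \sum_(0 <= j < n) inner u (e j) ^+ 2 <= C) -> `|u| ^+ 2 <= C.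
Proof.
move=> uC; rewrite -(cvg_lim _ (@parseval u))//.
apply: limr_le; last exact: nearW.
by apply/cvg_ex; eexists; exact: (@parseval u).
Qed.

Lemma parseval_nneseries u :
  (`|u| ^+ 2)%:E = (\sum_(j <oo) (inner u (e j) ^+ 2)%:E)%E.
Proof.
apply/esym/cvg_lim => //.
rewrite (_ : (fun n => _) = EFin \o (fun n => \sum_(0 <= j < n) inner u (e j) ^+ 2)).
  by move/cvg_comp : (@parseval u); apply.
by apply/funext => n; rewrite /= sumEFin.
Qed.

Context d (T : measurableType d) (P : probability T R).

Lemma integral_parseval (x : T -> X) :
  (forall v, measurable_fun setT (fun w => inner (x w) v)) ->
  (\int[P]_w (`|x w| ^+ 2)%:E =
   \sum_(j <oo) \int[P]_w (inner (x w) (e j) ^+ 2)%:E)%E.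
Proof.
move=> mx; under eq_integral do rewrite parseval_nneseries.
rewrite integral_nneseries// => [j|j w _]; last by rewrite lee_fin sqr_ge0.
by apply/measurable_EFinP; exact: measurable_funX.
Qed.

(** Weak measurability suffices, the squared norm being a countable sum of squared coordinates; sums
    of vectors are thus handled through real functions only. *)
Lemma measurable_sqnorm (x : T -> X) :
  (forall v, measurable_fun setT (fun w => inner (x w) v)) ->
  measurable_fun setT (fun w => `|x w| ^+ 2).
Proof.
move=> mx; apply/measurable_EFinP.
rewrite (_ : EFin \o _ = fun w => (\sum_(j <oo) (inner (x w) (e j) ^+ 2)%:E)%E).
  apply: ge0_emeasurable_sum => [j w _ _|j _]; first by rewrite lee_fin sqr_ge0.
  by apply/measurable_EFinP; exact: measurable_funX.
by apply/funext => w; rewrite /= parseval_nneseries.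
Qed.

End hilbert_valued.

End random_vectors.

(** * The empirical second moment matrix *)

Section second_moments.
Context {R : realType} {X : hilbertType R} (e : nat -> X).
Hypothesis parseval : forall u,
  (\sum_(0 <= j < n) inner u (e j) ^+ 2) @[n --> \oo] --> `|u| ^+ 2.
Context d (Om : measurableType d) (P : probability Om R).
Variables (x : Om -> X) (mu : X) (Sx : {linear X -> X}).
Hypotheses (x2 : square_integrable P x) (xmu : is_mean P x mu)
  (xS : is_covariance P x mu Sx).

Let x' w := x w - mu.

Lemma measurable_inner_random_vector (v : X) :
  measurable_fun setT (fun w => inner (x w) v).
Proof.
apply: random_vector_measurable; case: x2 => rx _.
exact: (random_vector_comp (@inner_continuousl R X v) rx).
Qed.

Lemma measurable_inner_centered (v : X) :
  measurable_fun setT (fun w => inner (x' w) v).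
Proof.
under eq_fun do rewrite innerBl.
apply: measurable_funB => //; exact: measurable_inner_random_vector.
Qed.

Lemma integrable_sqnorm : P.-integrable setT (fun w => (`|x w| ^+ 2)%:E).
Proof.
apply/integrableP; split.
  apply/measurable_EFinP; apply: (measurable_sqnorm parseval).
  exact: measurable_inner_random_vector.
under eq_integral do rewrite abse_EFin ger0_norm ?exprn_ge0//.
by case: x2 => _; rewrite unlock.
Qed.

Lemma integrable_sqnorm_centered : P.-integrable setT (fun w => (`|x' w| ^+ 2)%:E).
Proof.
apply: (@le_integrable _ _ _ P setT measurableT _
  (fun w => (cst (2 * `|mu| ^+ 2)%:E) w + 2%:E * (`|x w| ^+ 2)%:E)%E).
- apply/measurable_EFinP; apply: (measurable_sqnorm parseval).
  exact: measurable_inner_centered.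
- move=> w _; rewrite -EFinM -EFinD !abse_EFin lee_fin.
  rewrite ger0_norm ?exprn_ge0// ger0_norm; last first.
    by rewrite addr_ge0// mulr_ge0// exprn_ge0.
  have h := ler_normB (x w) mu.
  apply: (@le_trans _ _ ((`|x w| + `|mu|) ^+ 2)); first by rewrite lerXn2r ?nnegrE ?addr_ge0.
  by have := sqr_ge0 (`|x w| - `|mu|); rewrite sqrrB sqrrD; lra.
- apply: integrableD => //; first exact: finite_measure_integrable_cst.
  by apply: integrableZl => //; exact: integrable_sqnorm.
Qed.

Lemma integrable_inner_centered (v : X) :
  P.-integrable setT (fun w => (inner (x' w) v)%:E).
Proof.
apply: (@le_integrable _ _ _ P setT measurableT _
  (fun w => (cst (`|v| ^+ 2)%:E) w + (`|x' w| ^+ 2)%:E)%E).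
- by apply/measurable_EFinP; exact: measurable_inner_centered.
- move=> w _; rewrite -EFinD !abse_EFin lee_fin [leRHS]ger0_norm; last first.
    by rewrite addr_ge0// exprn_ge0.
  rewrite (le_trans (Cauchy_Schwarz _ _))//.
  have := sqr_ge0 (`|x' w| - `|v|); have := sqr_ge0 (`|x' w| + `|v|).
  by rewrite sqrrB sqrrD; lra.
- apply: integrableD => //; first exact: finite_measure_integrable_cst.
  exact: integrable_sqnorm_centered.
Qed.

Lemma integral_inner_random_vector (v : X) :
  (\int[P]_w (inner (x w) v)%:E = (inner mu v)%:E)%E.
Proof. by have := xmu v; rewrite unlock. Qed.

Lemma integral_inner_centered (v : X) :
  (\int[P]_w (inner (x' w) v)%:E = 0)%E.
Proof.
have := integral_inner_random_vector v.
have -> : (fun w => (inner (x w) v)%:E) =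
   (fun w => (inner (x' w) v)%:E + (cst (inner mu v)%:E) w)%E.
  by apply/funext => w; rewrite -EFinD innerBl subrK.
rewrite integralD//; last 2 first.
- exact: integrable_inner_centered.
- exact: finite_measure_integrable_cst.
rewrite integral_probability_cst -(fineK (integrable_fin_num _ (integrable_inner_centered v)))//.
by rewrite -EFinD => -[/eqP]; rewrite -subr_eq0 addrK => /eqP ->.
Qed.

Lemma integral_centered_product (u v : X) :
  (\int[P]_w (inner (x' w) u * inner (x' w) v)%:E = (inner (Sx u) v)%:E)%E.
Proof. by have := xS u v; rewrite unlock. Qed.

Lemma integrable_centered_product (u v : X) :
  P.-integrable setT (fun w => (inner (x' w) u * inner (x' w) v)%:E).
Proof.
apply: (@le_integrable _ _ _ P setT measurableT _
  (fun w => (`|u| * `|v|)%:E * (`|x' w| ^+ 2)%:E)%E).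
- by apply/measurable_EFinP; apply: measurable_funM; exact: measurable_inner_centered.
- move=> w _; rewrite -EFinM !abse_EFin lee_fin normrM [leRHS]ger0_norm; last first.
    by rewrite mulr_ge0 ?exprn_ge0// mulr_ge0.
  have -> : `|u| * `|v| * `|x' w| ^+ 2 = (`|x' w| * `|u|) * (`|x' w| * `|v|) by ring.
  by rewrite ler_pM// Cauchy_Schwarz.
- by apply: integrableZl => //; exact: integrable_sqnorm_centered.
Qed.

Lemma integral_product (u v : X) :
  (\int[P]_w (inner (x w) u * inner (x w) v)%:E =
   (inner (Sx u) v + inner mu u * inner mu v)%:E)%E.
Proof.
have -> : (fun w => (inner (x w) u * inner (x w) v)%:E) =
  (fun w => (inner (x' w) u * inner (x' w) v)%:E +
     ((inner mu u)%:E * (inner (x' w) v)%:E +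
     ((inner mu v)%:E * (inner (x' w) u)%:E +
      (cst (inner mu u * inner mu v)%:E) w)))%E.
  apply/funext => w; rewrite /= -!(EFinM, EFinD); congr EFin.
  by rewrite !innerBl; ring.
have i3 : P.-integrable setT (fun w => (inner (x' w) u)%:E).
  exact: integrable_inner_centered.
have i4 : P.-integrable setT (fun w => (inner (x' w) v)%:E).
  exact: integrable_inner_centered.
have ic : P.-integrable setT (cst (inner mu u * inner mu v)%:E : Om -> \bar R).
  exact: finite_measure_integrable_cst.
have i2 := integrable_centered_product u v.
have i1 : P.-integrable setT (fun w => ((inner mu v)%:E * (inner (x' w) u)%:E +
      (cst (inner mu u * inner mu v)%:E) w)%E).
  by apply: integrableD => //; exact: integrableZl.
have i0 : P.-integrable setT (fun w => ((inner mu u)%:E * (inner (x' w) v)%:E +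
  ((inner mu v)%:E * (inner (x' w) u)%:E + (cst (inner mu u * inner mu v)%:E) w))%E).
  by apply: integrableD => //; exact: integrableZl.
rewrite integralD// integralD//; last exact: integrableZl.
rewrite integralD//; last exact: integrableZl.
rewrite integral_probability_cst integralZl// integralZl//.
by rewrite !integral_inner_centered !mule0 !add0e integral_centered_product -EFinD.
Qed.

Lemma covariance_sym (u v : X) : inner (Sx u) v = inner u (Sx v).
Proof.
apply: EFin_inj; rewrite [inner u _]innerC -!integral_centered_product.
by apply: eq_integral => w _; rewrite mulrC.
Qed.

Lemma covariance_ge0 (u : X) : 0 <= inner (Sx u) u.
Proof.
rewrite -lee_fin -integral_centered_product; apply: integral_ge0 => w _.
by rewrite lee_fin -expr2 sqr_ge0.
Qed.

(** Written with the operator and the frame, not with the law of [x], so that it can serve in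
    constants chosen before the probability space. The series equals the integral of [|x - mu|^2],
    so [fine] does not truncate it. *)
Definition covariance_trace : R :=
  fine (\sum_(j <oo) (inner (Sx (e j)) (e j))%:E)%E.

Lemma integral_sqnorm_centered :
  (\int[P]_w (`|x' w| ^+ 2)%:E = covariance_trace%:E)%E.
Proof.
have fin := integrable_fin_num measurableT integrable_sqnorm_centered.
rewrite -(fineK fin) /covariance_trace; congr (fine _)%:E.
rewrite (integral_parseval parseval P); last exact: measurable_inner_centered.
by apply: eq_eseriesr => j _; rewrite -integral_centered_product.
Qed.

Lemma covariance_trace_ge0 : 0 <= covariance_trace.
Proof.
by rewrite fine_ge0//; apply: nneseries_ge0 => j _ _; rewrite lee_fin covariance_ge0.
Qed.

Lemma covariance_trace_ge (n : nat) :
  \sum_(0 <= j < n) inner (Sx (e j)) (e j) <= covariance_trace.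
Proof.
rewrite -lee_fin -integral_sqnorm_centered.
rewrite (integral_parseval parseval P); last exact: measurable_inner_centered.
rewrite -sumEFin.
rewrite [leRHS](_ : _ = \sum_(j <oo) (inner (Sx (e j)) (e j))%:E)%E; last first.
  by apply: eq_eseriesr => j _; rewrite -integral_centered_product.
apply: nneseries_lim_ge => j _ _; rewrite lee_fin; exact: covariance_ge0.
Qed.

Lemma covariance_bound (v : X) : `|Sx v| <= covariance_trace * `|v|.
Proof.
apply: norm_le_inner => [|u]; first by rewrite mulr_ge0 ?covariance_trace_ge0.
rewrite -lee_fin -abse_EFin -integral_centered_product.
rewrite (le_trans (le_abse_integral _ _ _))//.
  by apply/measurable_EFinP; apply: measurable_funM; exact: measurable_inner_centered.
have m2 : measurable_fun setT (fun w => (`|x' w| ^+ 2)%:E).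
  by have /integrableP[] := integrable_sqnorm_centered.
apply: (@le_trans _ _ (\int[P]_w ((`|v| * `|u|)%:E * (`|x' w| ^+ 2)%:E)))%E.
  apply: ge0_le_integral => //.
  - apply: measurableT_comp => //; apply/measurable_EFinP.
    by apply: measurable_funM; exact: measurable_inner_centered.
  - exact: measurable_funeM.
  - move=> w _; rewrite -EFinM abse_EFin lee_fin normrM.
    have -> : `|v| * `|u| * `|x' w| ^+ 2 = (`|x' w| * `|v|) * (`|x' w| * `|u|) by ring.
    by rewrite ler_pM// Cauchy_Schwarz.
rewrite ge0_integralZl_EFin//.
by rewrite integral_sqnorm_centered -EFinM lee_fin mulrC mulrA.
Qed.

Variable (kappa : R).
Hypothesis xsg : sub_Gaussian P kappa x.

(* The coordinates of the augmented vector [(1, x)], so that the empirical mean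
   and the empirical second moment are handled by a single matrix. *)
Definition feature (j : nat) (u : X) : R := if j is j'.+1 then inner u (e j') else 1.

Definition feature_mean (j l : nat) : R :=
  match j, l with
  | 0, 0 => 1
  | 0, l'.+1 => inner mu (e l')
  | j'.+1, 0 => inner mu (e j')
  | j'.+1, l'.+1 =>
    inner (Sx (e j')) (e l') + inner mu (e j') * inner mu (e l')
  end.

(* the summand [2^-j] keeps the scale positive in degenerate directions *)
Definition feature_scale (j : nat) : R :=
  if j is j'.+1 then
    (4 * expR 1 * kappa ^+ 2 + 1) *
    (inner (Sx (e j')) (e j') + inner mu (e j') ^+ 2 + 2^-1 ^+ j')
  else 1.

(** A bound for the sum of all scales: 1 for the constant coordinate, then the trace of the second
    moment and 2 for the sum of the [2^-j]. *)
Definition feature_trace : R :=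
  1 + (4 * expR 1 * kappa ^+ 2 + 1) * (covariance_trace + `|mu| ^+ 2 + 2).

Lemma feature_continuous j : continuous (feature j).
Proof.
by case: j => [|j] u; [exact: cvg_cst|exact: inner_continuousl].
Qed.

Lemma kappa_factor_ge1 : 1 <= 4 * expR 1 * kappa ^+ 2 + 1 :> R.
Proof. by rewrite lerDr mulr_ge0 ?sqr_ge0// mulr_ge0// expR_ge0. Qed.

Lemma feature_scale_gt0 j : 0 < feature_scale j.
Proof.
case: j => [|j] //=; rewrite mulr_gt0 ?(lt_le_trans ltr01 kappa_factor_ge1)//.
by rewrite ltr_wpDl ?exprn_gt0// addr_ge0 ?sqr_ge0 ?covariance_ge0.
Qed.

Lemma sum_feature_scale (n : nat) :
  \sum_(0 <= j < n) feature_scale j <= feature_trace.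
Proof.
have geo k : \sum_(0 <= j < k) 2^-1 ^+ j <= 2 :> R.
  suff : \sum_(0 <= j < k) 2^-1 ^+ j <= 2 - 2 * 2^-1 ^+ k :> R.
    by have : 0 <= 2^-1 ^+ k :> R by [rewrite exprn_ge0]; lra.
  elim: k => [|k ih]; first by rewrite big_geq// expr0; lra.
  by rewrite big_nat_recr//= exprS; move: ih; set u := \sum_(_ <= _ < _) _; lra.
have K1 := kappa_factor_ge1.
case: n => [|n].
  rewrite big_geq// addr_ge0// mulr_ge0 ?(le_trans ler01 K1)//.
  by rewrite !addr_ge0 ?sqr_ge0 ?covariance_trace_ge0.
rewrite big_nat_recl//= lerD2l -mulr_sumr ler_wpM2l ?(le_trans ler01 K1)//.
rewrite !big_split/= lerD// lerD// ?covariance_trace_ge//.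
exact: (parseval_le parseval).
Qed.

Lemma measurable_feature j : measurable_fun setT (fun w => feature j (x w)).
Proof. by case: j => [|j] //=; exact: measurable_inner_random_vector. Qed.

Lemma integral_feature_product j l :
  (\int[P]_w (feature j (x w) * feature l (x w))%:E = (feature_mean j l)%:E)%E.
Proof.
case: j l => [|j] [|l] /=.
- by under eq_integral do rewrite mulr1; exact: integral_probability_cst.
- by under eq_integral do rewrite mul1r; exact: integral_inner_random_vector.
- by under eq_integral do rewrite mulr1; exact: integral_inner_random_vector.
- exact: integral_product.
Qed.

Lemma feature_expR j :
  (\int[P]_w (expR (feature j (x w) ^+ 2 / feature_scale j))%:E <= (expR 1)%:E)%E.
Proof.
case: j => [|j] /=.
  under eq_integral do rewrite expr1n divr1.
  by rewrite integral_probability_cst.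
set q := inner (Sx (e j)) (e j) + inner mu (e j) ^+ 2.
have q0 : 0 <= q by rewrite addr_ge0 ?sqr_ge0 ?covariance_ge0.
apply: (@subgaussian_expR _ _ _ P _ kappa q).
- exact: measurable_inner_random_vector.
- by move=> p p1; exact: xsg.
- under eq_integral do rewrite expr2.
  by rewrite integral_product -expr2.
- exact: (feature_scale_gt0 j.+1).
have u0 : 0 <= 2^-1 ^+ j :> R by rewrite exprn_ge0.
have K0 : 0 <= 4 * expR 1 * kappa ^+ 2 :> R.
  by rewrite mulr_ge0 ?sqr_ge0// mulr_ge0// expR_ge0.
have := mulr_ge0 K0 u0; move: K0 u0 q0.
by set K := 4 * _ * _; set u := _ ^+ j; lra.
Qed.

Definition mgf_constant : R := 2 * expR (1 + expR 1).

Lemma feature_product_mgf j l t : `|t| <= 1 ->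
  (\int[P]_w (expR (t * ((feature j (x w) * feature l (x w) - feature_mean j l) /
     (2 * Num.sqrt (feature_scale j * feature_scale l)))))%:E
   <= (expR (mgf_constant * t ^+ 2))%:E)%E.
Proof.
move=> t1; apply: centered_product_mgf => //.
- exact: measurable_feature.
- exact: measurable_feature.
- exact: feature_scale_gt0.
- exact: feature_scale_gt0.
- exact: feature_expR.
- exact: feature_expR.
- exact: integral_feature_product.
Qed.

Context d' (Om' : measurableType d') (Q : probability Om' R) (m : nat)
  (xs : 'I_m -> Om' -> X).
Hypothesis iid : iid_copies P Q x xs.

Definition feature_deviation (j l : nat) (w : Om') : R :=
  \sum_i (feature j (xs i w) * feature l (xs i w) - feature_mean j l).

(** The truncated sums of squares increase with [n], so the bad events are nested and their union
    has the same probability bound as each of them. The factor 4 in front of [feature_trace ^+ 2] is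
    the square of the 2 in the scale of a product. *)
Lemma feature_deviation_event (k : nat) : (0 < k)%N -> (k <= m)%N ->
  exists E : set Om', [/\ measurable E,
    ((1 - 2 * expR (- k%:R))%:E <= Q E)%E &
    forall w, E w -> forall n,
      \sum_(p : 'I_n * 'I_n) feature_deviation p.1 p.2 w ^+ 2 <=
      4 * k%:R * m%:R * expR (mgf_constant + 1) * (4 * feature_trace ^+ 2)].
Proof.
move=> k0 km; case: iid => rxs lawxs indxs.
set s := 4 * _ * _ * _ * _.
pose xi (j l : nat) (i : 'I_m) w :=
  feature j (xs i w) * feature l (xs i w) - feature_mean j l.
pose phi (j l : nat) (u : X) := feature j u * feature l u - feature_mean j l.
have cphi j l : continuous (phi j l).
  move=> u; apply: cvgB; last exact: cvg_cst.
  by apply: cvgM; exact: feature_continuous.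
have mxi j l i : measurable_fun setT (xi j l i).
  apply: random_vector_measurable.
  exact: (random_vector_comp (cphi j l) (rxs i)).
pose V n w := \sum_(p : 'I_n * 'I_n) feature_deviation p.1 p.2 w ^+ 2.
have mV n : measurable_fun setT (V n).
  apply: measurable_sum => p; apply: measurable_funX.
  by apply: measurable_sum => i; exact: mxi.
pose bad n := [set w | s < V n w].
have mbad n : measurable (bad n).
  by have := mV n measurableT _ (measurable_itv `]s, +oo[); rewrite setTI set_itvoy.
have VE n w : V n w = \sum_(j < n) \sum_(l < n) feature_deviation j l w ^+ 2.
  by rewrite /V pair_big.
have VS n w : V n w <= V n.+1 w.
  rewrite !VE big_ord_recr /= ler_wpDr//.
    by apply: sumr_ge0 => l _; rewrite sqr_ge0.
  by apply: ler_sum => j _; rewrite big_ord_recr /= lerDl sqr_ge0.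
have Qbad n : (Q (bad n) <= (2 * expR (- k%:R))%:E)%E.
  have := @sum_squares_tail _ _ _ Q ('I_n * 'I_n)%type m k
    (fun p => xi p.1 p.2)
    (fun p => 2 * Num.sqrt (feature_scale p.1 * feature_scale p.2))
    mgf_constant (4 * feature_trace ^+ 2) k0 km.
  apply.
  - by move=> p; rewrite mulr_gt0// sqrtr_gt0 mulr_gt0// feature_scale_gt0.
  - rewrite mulr_gt0// exprn_gt0// ltr_wpDr//.
    rewrite mulr_ge0 ?(le_trans ler01 kappa_factor_ge1)//.
    by rewrite !addr_ge0 ?sqr_ge0 ?covariance_trace_ge0.
  - under eq_bigr do rewrite exprMn sqr_sqrtr ?mulr_ge0 ?(ltW (feature_scale_gt0 _))//.
    rewrite -mulr_sumr (_ : 2 ^+ 2 = 4); last by ring.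
    rewrite ler_pM2l//.
    rewrite -(pair_big xpredT xpredT (fun j l : 'I_n => feature_scale j * feature_scale l))/=.
    under eq_bigr do rewrite -mulr_sumr.
    rewrite -mulr_suml -expr2 -(big_mkord xpredT feature_scale).
    rewrite lerXn2r ?nnegrE ?sum_feature_scale//.
      by apply: sumr_ge0 => j _; exact: ltW (feature_scale_gt0 _).
    apply: le_trans (sum_feature_scale 0).
    by rewrite big_geq.
  - by move=> p i; exact: mxi.
  - move=> p B mB.
    apply: (indxs (fun i => phi p.1 p.2 @^-1` B i)) => i.
    by apply: (borel_preimage (cphi p.1 p.2)); exact: measurable_borel.
  - move=> p i t t1.
    have mg : measurable_fun setT (fun y : R => expR (t * (y /
        (2 * Num.sqrt (feature_scale p.1 * feature_scale p.2))))).
      apply: measurableT_comp => //; apply: measurable_funM => //.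
      exact: measurable_funM.
    rewrite (@eq_law_integral _ _ _ _ _ P Q (fun w => phi p.1 p.2 (x w)) (xi p.1 p.2 i)
       (fun y : R => expR (t * (y / (2 * Num.sqrt (feature_scale p.1 * feature_scale p.2))))))//.
    + exact: feature_product_mgf.
    + apply: random_vector_measurable; case: x2 => rx _.
      exact: (random_vector_comp (cphi p.1 p.2) rx).
    + move=> B mB; apply: (lawxs i (phi p.1 p.2 @^-1` B)).
      by apply: (borel_preimage (cphi p.1 p.2)); exact: measurable_borel.
have mB : measurable (\bigcup_n bad n) by exact: bigcupT_measurable.
have Qb : (Q (\bigcup_n bad n) <= (2 * expR (- k%:R))%:E)%E.
  have nd : nondecreasing_seq bad.
    apply/nondecreasing_seqP => n; apply/subsetPset => w /= h.
    exact: lt_le_trans (VS n w).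
  have cv := nondecreasing_cvg_mu (mu := Q) mbad mB nd.
  rewrite -(cvg_lim _ cv)//; apply: lime_le; last exact: nearW.
  by apply/cvg_ex; eexists; exact: cv.
exists (~` \bigcup_n bad n); split.
- exact: measurableC.
- rewrite probability_setC// EFinB; apply: leeB => //.
- move=> w wE n; rewrite leNgt; apply/negP => h.
  by apply: wE; exists n.
Qed.

End second_moments.

(** * Empirical covariance, noise and expected error *)

Section sample_deviation.
Context {R : realType} {X : hilbertType R} (e : nat -> X).
Hypothesis parseval : forall u,
  (\sum_(0 <= j < n) inner u (e j) ^+ 2) @[n --> \oo] --> `|u| ^+ 2.

(** By symmetry the coordinates of [U v] are [<v, U e_l>], so [|U v|^2] is at most [|v|^2] times the
    sum of the [|U e_l|^2]. *)
Lemma hilbert_schmidt_bound (U : {linear X -> X}) (r : R) : 0 <= r ->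
  (forall u v, inner (U u) v = inner u (U v)) ->
  (forall n, \sum_(0 <= l < n) \sum_(0 <= j < n) inner (U (e l)) (e j) ^+ 2 <= r ^+ 2) ->
  forall v, `|U v| <= r * `|v|.
Proof.
move=> r0 Usym HS v.
have HSn n : \sum_(0 <= l < n) `|U (e l)| ^+ 2 <= r ^+ 2.
  (* Only square truncations are controlled: [n] is fixed, the inner range grows, and the rectangle
     lies in the square of side [N] once [n <= N]. *)
  have cv : (\sum_(0 <= l < n) \sum_(0 <= j < N) inner (U (e l)) (e j) ^+ 2)
      @[N --> \oo] --> \sum_(0 <= l < n) `|U (e l)| ^+ 2.
    apply: cvg_big => [|l _]; first exact: add_continuous.
    exact: (@parseval (U (e l))).
  rewrite -(cvg_lim _ cv)//; apply: limr_le.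
    by apply/cvg_ex; eexists; exact: cv.
  near=> N; apply: le_trans (HS N).
  have nN : (n <= N)%N by near: N; exists n.
  rewrite [leRHS](big_cat_nat (n := n))//= lerDl.
  by apply: sumr_ge0 => l _; apply: sumr_ge0 => j _; rewrite sqr_ge0.
rewrite -(@ler_pXn2r _ 2)// ?nnegrE ?mulr_ge0//.
apply: (parseval_ge parseval) => n; rewrite exprMn mulrC.
apply: (@le_trans _ _ (\sum_(0 <= l < n) `|v| ^+ 2 * `|U (e l)| ^+ 2)).
  apply: ler_sum => l _; rewrite Usym -exprMn -[leLHS]real_normK ?num_real//.
  by rewrite lerXn2r ?nnegrE ?mulr_ge0// Cauchy_Schwarz.
by rewrite -mulr_sumr ler_wpM2l ?sqr_ge0.
Unshelve. all: by end_near. Qed.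

Context (mu : X) (Sx : {linear X -> X}) (T : Type) (m : nat)
  (xs : 'I_m -> T -> X) (w : T) (r : R).
Hypotheses (m0 : (0 < m)%N) (r0 : 0 <= r)
  (Sx_sym : forall u v, inner (Sx u) v = inner u (Sx v)).
Hypothesis dev : forall n,
  \sum_(p : 'I_n * 'I_n) (\sum_i (feature e p.1 (xs i w) * feature e p.2 (xs i w)
    - feature_mean e mu Sx p.1 p.2)) ^+ 2 <= (m%:R * r) ^+ 2.

Let G j l := \sum_i (feature e j (xs i w) * feature e l (xs i w)
    - feature_mean e mu Sx j l).

Let dev2 n : \sum_(0 <= j < n) \sum_(0 <= l < n) G j l ^+ 2 <= (m%:R * r) ^+ 2.
Proof.
apply: le_trans (dev n); rewrite big_mkord.
under eq_bigr do rewrite big_mkord.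
by rewrite (pair_big xpredT xpredT (fun j l : 'I_n => G j l ^+ 2)).
Qed.

Let mR : 0 < m%:R :> R. Proof. by rewrite ltr0n. Qed.

(** Row 0 of the deviation matrix, which pairs the constant feature with the coordinates, is [m]
    times the error of the mean. *)
Lemma sample_mean_deviation : `|sample_mean xs w - mu| <= r.
Proof.
rewrite -(@ler_pXn2r _ 2)// ?nnegrE//.
apply: (parseval_ge parseval) => n.
have GE l : G 0 l.+1 = m%:R * inner (sample_mean xs w - mu) (e l).
  rewrite /G /= sumrB; under eq_bigr do rewrite mul1r.
  rewrite innerBl innerZl -inner_suml mulrBr mulrA divff ?gt_eqF// mul1r.
  by rewrite sumr_const card_ord mulr_natl.
rewrite -(ler_pM2l (x := m%:R ^+ 2)) ?exprn_gt0// -[leRHS]exprMn.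
apply: le_trans (dev2 n.+1).
rewrite big_nat_recl// big_nat_recl//= mulr_sumr.
apply: (@le_trans _ _ (\sum_(0 <= l < n) G 0 l.+1 ^+ 2)).
  by apply: ler_sum => l _; rewrite GE exprMn.
rewrite -[leLHS]addr0 lerD//.
  by rewrite lerDr sqr_ge0.
by apply: sumr_ge0 => j _; apply: sumr_ge0 => l _; rewrite sqr_ge0.
Qed.

Lemma sample_covarianceE v : sample_covariance xs w v =
  m%:R^-1 *: \sum_i tensor (xs i w) v - tensor (sample_mean xs w) v.
Proof.
apply: inner_eqP => u; rewrite innerBl !innerZl !inner_suml.
set M := sample_mean xs w.
have ME z : m%:R^-1 * \sum_i inner (xs i w) z = inner M z.
  by rewrite /M innerZl inner_suml.
have -> : \sum_i inner (tensor (xs i w - M) v) u =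
  \sum_i inner (tensor (xs i w) v) u - inner M v * \sum_i inner (xs i w) u
   - inner M u * \sum_i inner (xs i w) v + m%:R * (inner M v * inner M u).
  rewrite !mulr_sumr -!sumrB -[m in m%:R * _](card_ord m) mulr_natl -sumr_const.
  rewrite -big_split; apply: eq_bigr => i _ /=.
  clear ME; clearbody M.
  by rewrite /tensor !innerZl !innerBr !innerBl ![inner v _]innerC; ring.
rewrite mulrDr mulrBr mulrBr mulrA mulVf ?gt_eqF// mul1r.
rewrite ![m%:R^-1 * (inner M _ * _)]mulrCA !ME.
by rewrite (innerC v) ; ring.
Qed.

(** The block of the matrix without row and column 0 is the deviation of the uncentred second
    moment, of norm at most [r]; replacing the centre [mu] by the sample mean costs the difference
    of two rank-one operators, the term [r (r + 2 |mu|)]. *)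
Lemma sample_covariance_deviation v :
  `|sample_covariance xs w v - Sx v| <= (r + r * (r + 2 * `|mu|)) * `|v|.
Proof.
have md := sample_mean_deviation.
set M := sample_mean xs w in md *.
pose U0 (u : X) := m%:R^-1 *: \sum_i tensor (xs i w) u - (Sx u + tensor mu u).
have U0E u z : inner (U0 u) z =
    m%:R^-1 * \sum_i inner (xs i w) u * inner (xs i w) z -
    (inner (Sx u) z + inner mu u * inner mu z).
  rewrite innerBl innerZl inner_suml innerDl innerZl (innerC u); congr (_ * _ - _).
  by apply: eq_bigr => i _; rewrite innerZl innerC.
have lU : linear U0.
  move=> c u z; apply: inner_eqP => y.
  rewrite [RHS]innerDl [inner (c *: _) _]innerZl !U0E linearP !(innerDl, innerDr, innerZl, innerZr).
  have -> : \sum_i inner (xs i w) (c *: u + z) * inner (xs i w) y =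
    c * \sum_i inner (xs i w) u * inner (xs i w) y +
    \sum_i inner (xs i w) z * inner (xs i w) y.
    rewrite mulr_sumr -big_split; apply: eq_bigr => i _ /=.
    by rewrite innerDr innerZr; ring.
  by ring.
have [U UE] := linear_pack lU.
have Usym u z : inner (U u) z = inner u (U z).
  rewrite UE [RHS]innerC !U0E Sx_sym (innerC u (Sx z)).
  rewrite (mulrC (inner mu u)); congr (_ * _ - _).
  by apply: eq_bigr => i _; rewrite mulrC.
have GE j l : G j.+1 l.+1 = m%:R * inner (U (e j)) (e l).
  rewrite UE U0E /G /= sumrB mulrBr mulrA divff ?gt_eqF// mul1r.
  by rewrite sumr_const card_ord mulr_natl.
have Ule z : `|U z| <= r * `|z|.
  apply: hilbert_schmidt_bound => // n.
  rewrite -(ler_pM2l (x := m%:R ^+ 2)) ?exprn_gt0// -[leRHS]exprMn.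
  apply: le_trans (dev2 n.+1).
  rewrite big_nat_recl//= mulr_sumr ler_wpDl//.
    by apply: sumr_ge0 => l _; rewrite sqr_ge0.
  apply: ler_sum => j _; rewrite big_nat_recl//= mulr_sumr ler_wpDl ?sqr_ge0//.
  by apply: ler_sum => l _; rewrite GE exprMn.
have -> : sample_covariance xs w v - Sx v = U v - (tensor M v - tensor mu v).
  rewrite sample_covarianceE UE /U0 -/M.
  set a := _ *: _; set b := tensor M v; set c := tensor mu v; set d := Sx v.
  by rewrite opprB opprD !addrA [RHS](ACl (1*5*2*4*3))/= addrK.
have -> : tensor M v - tensor mu v =
    inner v (M - mu) *: M + inner v mu *: (M - mu).
  by rewrite /tensor innerBr scalerBl scalerBr addrA subrK.
rewrite (le_trans (ler_normB _ _))// mulrDl lerD//.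
rewrite (le_trans (ler_normD _ _))//.
rewrite [`|inner v (M - mu) *: M|]normrZ [`|inner v mu *: _|]normrZ.
have h1 : `|inner v (M - mu)| <= `|v| * r.
  by rewrite (le_trans (Cauchy_Schwarz _ _))// ler_wpM2l.
have h2 : `|M| <= r + `|mu|.
  by rewrite -[M](subrK mu) (le_trans (ler_normD _ _))// lerD2r.
have -> : r * (r + 2 * `|mu|) * `|v| =
  `|v| * r * (r + `|mu|) + `|v| * `|mu| * r by ring.
by rewrite lerD// ler_pM// ?Cauchy_Schwarz.
Qed.

End sample_deviation.

(** * Second moment of the noise seen through [W] *)

Section noise.
Context {R : realType} {X Y K : hilbertType R} (e : nat -> X).
Hypothesis parseval : forall u,
  (\sum_(0 <= j < n) inner u (e j) ^+ 2) @[n --> \oo] --> `|u| ^+ 2.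
Variables (A : {linear X -> Y}) (Sx : {linear X -> X}) (Se : {linear Y -> Y}).

(** The [y_j] of the overview when [v = e_j]. It is specified by an equation in [Y], so that
    [noise_trace] is available before [K] and the noise are given; coercivity makes the solution
    unique. *)
Definition noise_representative (v : X) : Y :=
  get [set y | Se y + A (Sx (adjoint A y)) = A v].

Definition noise_trace : R :=
  fine (\sum_(j <oo) (inner (Se (noise_representative (e j)))
                            (noise_representative (e j)))%:E)%E.

Context d (Om : measurableType d) (P : probability Om R)
  (eps : Y -> Om -> R) (iota : {linear K -> Y}) (epsK : Om -> dual K).
Hypothesis leps : linear_process P Se eps.

Lemma process_covariance (u v : Y) :
  (\int[P]_w (eps u w * eps v w)%:E = (inner (Se u) v)%:E)%E.
Proof. by case: leps => _ _ _ /(_ u v); rewrite unlock. Qed.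

(** Symmetry, and non-negativity below, are inherited from the process of which [Se] is the
    covariance. *)
Lemma process_covariance_sym (u v : Y) : inner (Se u) v = inner u (Se v).
Proof.
apply: EFin_inj; rewrite [inner u _]innerC -!process_covariance.
by apply: eq_integral => w _; rewrite mulrC.
Qed.

Lemma process_covariance_ge0 (u : Y) : 0 <= inner (Se u) u.
Proof.
rewrite -lee_fin -process_covariance; apply: integral_ge0 => w _.
by rewrite lee_fin -expr2 sqr_ge0.
Qed.

Variables (b : R) (W : {linear dual K -> X}).
Hypotheses (cA : continuous A) (ci : continuous iota) (b0 : 0 < b)
  (Se_coercive : forall u, `|u| ^+ 2 <= b * inner (Se u) u)
  (Sx_sym : forall u v, inner (Sx u) v = inner u (Sx v))
  (Sx_ge0 : forall u, 0 <= inner (Sx u) u)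
  (epsKP : dual_noise P iota eps epsK) (cW : continuous W)
  (WE : forall u, W (dual_adjoint iota (Se u + A (Sx (adjoint A u)))) = adjoint A u).

(* [W eps] tested against [v] is the process evaluated at a vector of [Y] which
   does not depend on [K]. *)
Lemma noise_evaluation (v : X) : exists k : K,
  iota k = noise_representative v /\ forall phi, inner (W phi) v = phi k.
Proof.
have [k kP] := dual_evaluation v cW.
exists k; split => //.
(* Tested against [y]: the symmetric operator on the left is moved onto [y], pairing with [iota k]
   becomes evaluation of [iota^*] at [k], hence [W] tested against [v], and [WE] reduces it to the
   adjoint of [A] at [y]. *)
have Mk : Se (iota k) + A (Sx (adjoint A (iota k))) = A v.
  apply: inner_eqP => y.
  rewrite innerDl [inner (A (Sx _)) y]adjointE// Sx_sym.
  rewrite [inner (adjoint A _) _]innerC -adjointE//.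
  rewrite process_covariance_sym [inner (A _) (iota k)]innerC -innerDr.
  by rewrite innerC -dual_adjointE// -kP WE [RHS]adjointE// innerC.
have uniq y : Se y + A (Sx (adjoint A y)) = 0 -> y = 0.
  move=> y0; apply/eqP; rewrite -normr_eq0 -sqrf_eq0 eq_le sqr_ge0 andbT.
  have := perturbed_coercive cA b0 Se_coercive Sx_ge0 y.
  by rewrite addrC y0 inner0l mulr0.
have [At AtE] := linear_pack (adjoint_linear cA).
have gP : Se (noise_representative v) + A (Sx (adjoint A (noise_representative v))) = A v.
  exact: (getPex (ex_intro (fun y => Se y + A (Sx (adjoint A y)) = A v) _ Mk)).
apply/eqP; rewrite -subr_eq0; apply/eqP; apply: uniq.
rewrite -AtE in Mk gP *.
by rewrite !linearB /= addrACA -opprD Mk gP subrr.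
Qed.

Lemma measurable_inner_noise (v : X) :
  measurable_fun setT (fun w => inner (W (epsK w)) v).
Proof.
case: epsKP => -[rK _] _ _; apply: random_vector_measurable.
apply: (random_vector_comp (f := fun phi => inner (W phi) v) _ rK).
move=> phi; apply: (@continuous_comp _ _ _ W (fun u => inner u v)).
  exact: cW.
exact: inner_continuousl.
Qed.

Lemma noise_second_moment (v : X) :
  (\int[P]_w (inner (W (epsK w)) v ^+ 2)%:E =
   (inner (Se (noise_representative v)) (noise_representative v))%:E)%E.
Proof.
have [k [ik kP]] := noise_evaluation v.
rewrite -ik -process_covariance; apply: ae_eq_integral => //.
- apply/measurable_EFinP; apply: measurable_funX.
  exact: measurable_inner_noise.
- apply/measurable_EFinP; case: leps => me _ _ _.
  by apply: measurable_funM; exact: me.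
- case: epsKP => _ _ /(_ k); apply: filterS => w h _.
  by rewrite kP h expr2.
Qed.

(** The norm of [W] serves here only for finiteness, which makes [fine] harmless; the value is then
    computed coordinate by coordinate, without [K]. *)
Lemma integral_sqnorm_noise :
  (\int[P]_w (`|W (epsK w)| ^+ 2)%:E = noise_trace%:E)%E.
Proof.
have fin : (\int[P]_w (`|W (epsK w)| ^+ 2)%:E \is a fin_num)%E.
  rewrite ge0_fin_numE; last first.
    by apply: integral_ge0 => w _; rewrite lee_fin exprn_ge0.
  have [C C0 WC] := linear_continuous_bound cW.
  have m1 : measurable_fun setT (fun w => (`|W (epsK w)| ^+ 2)%:E).
    apply/measurable_EFinP; apply: (measurable_sqnorm parseval).
    exact: measurable_inner_noise.
  have nc : continuous (fun phi : dual K => `|phi| ^+ 2).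
    have nc1 : continuous (fun phi : dual K => `|phi| : R) by exact: norm_continuous.
    by move=> phi; exact: (cvgM (nc1 phi) (nc1 phi)).
  case: epsKP => -[rK K2] _ _.
  have m2 : measurable_fun setT (fun w => (`|epsK w| ^+ 2)%:E).
    apply/measurable_EFinP; apply: random_vector_measurable.
    exact: (random_vector_comp nc rK).
  apply: (@le_lt_trans _ _ (\int[P]_w ((C ^+ 2)%:E * (`|epsK w| ^+ 2)%:E))%E).
    apply: ge0_le_integral => //.
    - exact: measurable_funeM.
    - move=> w _; rewrite -EFinM lee_fin -exprMn lerXn2r ?nnegrE//.
      by rewrite mulr_ge0// ltW.
  rewrite ge0_integralZl_EFin// ?exprn_ge0// ?(ltW C0)//.
  rewrite lte_mul_pinfty ?lee_fin ?exprn_ge0// ?(ltW C0)//.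
  by move: K2; rewrite unlock.
rewrite -(fineK fin) /noise_trace; congr (fine _)%:E.
rewrite (integral_parseval parseval P); last exact: measurable_inner_noise.
by apply: eq_eseriesr => j _; exact: noise_second_moment.
Qed.

End noise.

Section expected_error.
Context {R : realType}.

(** Domination of [F2] and of the difference makes both functions integrable, so that the
    subtraction of extended reals is a genuine one. *)
Lemma integral_dist_le d (T : measurableType d) (P : probability T R)
    (F1 F2 G : T -> R) (c c' g : R) :
  measurable_fun setT F1 -> measurable_fun setT F2 -> measurable_fun setT G ->
  0 <= c -> (forall w, 0 <= G w) -> (\int[P]_w (G w)%:E = g%:E)%E ->
  (forall w, `|F1 w - F2 w| <= c * G w) -> (forall w, `|F2 w| <= c' * G w) ->
  (`|\int[P]_w (F1 w)%:E - \int[P]_w (F2 w)%:E| <= (c * g)%:E)%E.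
Proof.
move=> m1 m2 mG c0 G0 Gg F12 F2G.
have iG : P.-integrable setT (EFin \o G).
  apply/integrableP; split; first exact/measurable_EFinP.
  under eq_integral do rewrite /= ger0_norm//.
  by rewrite Gg ltry.
have dom (F : T -> R) k : measurable_fun setT F -> (forall w, `|F w| <= k * G w) ->
    P.-integrable setT (EFin \o F).
  move=> mF Fk; apply: (@le_integrable _ _ _ P setT measurableT _
    (fun w => k%:E * (G w)%:E)%E).
  - exact/measurable_EFinP.
  - move=> w _; rewrite -EFinM !abse_EFin lee_fin (le_trans (Fk w))//.
    exact: ler_norm.
  - exact: integrableZl.
have i2 := dom F2 c' m2 F2G.
have i1 : P.-integrable setT (EFin \o F1).
  apply: (dom F1 (c + c')) => // w; rewrite mulrDl.
  rewrite -[F1 w](subrK (F2 w)) (le_trans (ler_normD _ _))//.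
  exact: lerD.
rewrite -integralB_EFin//.
rewrite (le_trans (le_abse_integral _ _ _))//.
  by apply/measurable_EFinP; exact: measurable_funB.
apply: (@le_trans _ _ (\int[P]_w (c%:E * (G w)%:E))%E).
  apply: ge0_le_integral => //.
  - apply: measurableT_comp => //.
    by apply/measurable_EFinP; exact: measurable_funB.
  - by apply: measurable_funeM; exact/measurable_EFinP.
  - by move=> w _; rewrite -EFinM abse_EFin lee_fin.
rewrite ge0_integralZl_EFin//; last 2 first.
- by move=> w _; rewrite lee_fin.
- exact/measurable_EFinP.
by rewrite Gg -EFinM.
Qed.

Context {X Y K : hilbertType R}.
Variables (A : {linear X -> Y}) (iota : {linear K -> Y}) (Se : {linear Y -> Y}).

(** Both branches of [xget] are bounded linear maps, the default being zero; this yields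
    measurability of the error for every [B]. *)
Lemma gain_linear_continuous (B : X -> X) :
  exists2 g : {linear dual K -> X}, g = gain A iota Se B :> (dual K -> X) &
    continuous g.
Proof.
rewrite /gain; case: xgetP => [W _ [lW cW _]|_].
  by have [g gE] := linear_pack lW; exists g => //; rewrite gE.
have l0 : linear ((fun=> 0) : dual K -> X) by move=> c u v; rewrite scaler0 addr0.
have [g gE] := linear_pack l0; exists g => //.
apply: (@linear_bound_continuous _ _ _ _ 0) => u.
by rewrite gE mul0r normr0.
Qed.

Lemma dual_adjoint_continuous : continuous iota ->
  exists2 g : {linear Y -> dual K}, g = dual_adjoint iota :> (Y -> dual K) &
    continuous g.
Proof.
move=> ci.
have li : linear (dual_adjoint iota).
  move=> c y z; apply: dual_eq => v.
  by rewrite dualD dualZ !dual_adjointE// innerDl innerZl.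
have [g gE] := linear_pack li; exists g => //.
have [C C0 iC] := linear_continuous_bound ci.
apply: (@linear_bound_continuous _ _ _ _ C) => y; rewrite gE.
apply: dual_norm_le => v v1; rewrite dual_adjointE//.
rewrite (le_trans (Cauchy_Schwarz _ _))// mulrC ler_wpM2r//.
by rewrite (le_trans (iC v))// ler_piMr// ltW.
Qed.

Lemma measurable_error (e : nat -> X) d (Om : measurableType d)
    (x : Om -> X) (epsK : Om -> dual K) (h : X) (B : X -> X) :
  (forall u, (\sum_(0 <= j < n) inner u (e j) ^+ 2) @[n --> \oo] --> `|u| ^+ 2) ->
  continuous A -> continuous iota -> random_vector x -> random_vector epsK ->
  measurable_fun setT (fun w =>
    `|reconstruction A iota Se h B (observation A iota x epsK w) - x w| ^+ 2).
Proof.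
move=> parseval cA ci rx rK; apply: (measurable_sqnorm parseval) => v.
have [g gE cg] := gain_linear_continuous B.
have [js jsE cjs] := dual_adjoint_continuous ci.
rewrite /reconstruction /observation -gE -jsE.
under eq_fun do rewrite innerBl innerDl linearB linearD /= innerBl innerDl.
apply: measurable_funB.
  apply: measurable_funD => //; apply: measurable_funB => //.
  apply: measurable_funD.
    apply: random_vector_measurable.
    apply: (random_vector_comp (f := fun u => inner (g (js (A u))) v) _ rx) => u.
    apply: (@continuous_comp _ _ _ (fun u => g (js (A u))) (fun z => inner z v)).
      apply: (@continuous_comp _ _ _ (fun u => js (A u)) g); last exact: cg.
      by apply: (@continuous_comp _ _ _ A js); [exact: cA|exact: cjs].
    exact: inner_continuousl.
  apply: random_vector_measurable.
  apply: (random_vector_comp (f := fun u => inner (g u) v) _ rK) => u.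
  apply: (@continuous_comp _ _ _ g (fun z => inner z v)); first exact: cg.
  exact: inner_continuousl.
apply: random_vector_measurable.
exact: (random_vector_comp (@inner_continuousl R X v) rx).
Qed.

End expected_error.

(** The margin 1 absorbs the factor 2, and strictness comes from [e > 2]. *)
Lemma expRN_tail (R : realType) (tau : R) (k : nat) : tau + 1 <= k%:R ->
  2 * expR (- k%:R) < expR (- tau).
Proof.
move=> tk; apply: (@le_lt_trans _ _ (2 * expR (- (tau + 1)))).
  by rewrite ler_pM2l// ler_expR lerN2.
rewrite opprD expRD mulrCA gtr_pMr ?expR_gt0//.
rewrite expRN ltr_pdivrMr ?expR_gt0// mul1r.
by have := expR_gt1Dx (oner_neq0 R); lra.
Qed.

Lemma sqrtr_addr_le (R : realType) (s t : R) : 0 <= s -> 0 <= t ->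
  Num.sqrt (s + t) <= Num.sqrt s + Num.sqrt t.
Proof.
move=> s0 t0; rewrite -(@ler_pXn2r _ 2)// ?nnegrE ?addr_ge0 ?sqrtr_ge0//.
rewrite sqr_sqrtr ?addr_ge0// sqrrD !sqr_sqrtr//.
have : 0 <= Num.sqrt s * Num.sqrt t by rewrite mulr_ge0 ?sqrtr_ge0.
lra.
Qed.

Theorem theorem4p2 (R : realType) (X Y : hilbertType R) (A : {linear X -> Y})
    (Sx : {linear X -> X}) (Se : {linear Y -> Y}) (mu : X) (kappa : R) :
  separable X -> separable Y -> continuous A ->
  injective Sx -> continuous Se -> injective Se ->
  (exists T, bounded_inverse Se T) ->
  exists c3 c4 : R, forall tau : R, 0 < tau -> exists m0 : nat,
  forall (d : measure_display) (Omega : measurableType d)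
    (P : probability Omega R) (x : Omega -> X) (eps : Y -> Omega -> R)
    (K : hilbertType R) (iota : {linear K -> Y}) (epsK : Omega -> dual K),
  square_integrable P x -> is_mean P x mu -> is_covariance P x mu Sx ->
  linear_process P Se eps -> independent_process P x eps ->
  separable K -> continuous iota -> injective iota -> dense (range iota) ->
  trace_class (fun v => dual_adjoint iota (Se (iota v))) ->
  dual_noise P iota eps epsK ->
  sub_Gaussian P kappa x ->
  (exists W, bounded_extension
    (fun u => dual_adjoint iota (Se u + A (Sx (adjoint A u))))
    (adjoint A) W) ->
  forall m : nat, (m0 <= m)%N ->
  forall (d' : measure_display) (Omega' : measurableType d')
    (Q : probability Omega' R) (xs : 'I_m -> Omega' -> X)
    (Bstar : X -> X) (Bhat : Omega' -> X -> X),
  iid_copies P Q x xs ->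
  is_sqrt Sx Bstar ->
  (forall w, is_sqrt (sample_covariance xs w) (Bhat w)) ->
  exists E : set Omega',
    [/\ measurable E, ((1 - expR (- tau))%:E < Q E)%E &
      forall w, E w ->
        (`|expected_error A iota Se P x epsK (sample_mean xs w) (Bhat w) -
           expected_error A iota Se P x epsK mu Bstar|
         <= ((c3 + c4 * Num.sqrt tau) / Num.sqrt m%:R)%:E)%E].
Proof.
move=> sX _ cA _ cSe _ [T [lT cT _ ST]].
have [e parseval] := parseval_frame sX.
have [alpha alpha0 A_le] := linear_continuous_bound cA.
have [b b0 T_le] : exists2 b, 0 < b & forall y, `|T y| <= b * `|y|.
  have [g gE] := linear_pack lT; rewrite -gE.
  by apply: linear_continuous_bound; rewrite gE.
(* For [r <= 1], the covariance deviation [r + r (r + 2 |mu|)] is at most [gamma r]. *)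
pose sigma := covariance_trace e Sx; pose gamma := 2 + 2 * `|mu|.
pose zeta := noise_trace e A Sx Se.
(* The threshold of the deviation event is [D k m]; divided by [m^2] it is [r^2 = D k / m]. *)
pose D := 4 * expR (mgf_constant + 1) * (4 * feature_trace e mu Sx kappa ^+ 2) : R.
pose ec := error_constant b alpha sigma gamma.
pose c4 := ec * (1 + sigma + zeta) * Num.sqrt D.
(* [k <= tau + 2] gives [sqrt k <= sqrt 2 + sqrt tau], whence the two constants. *)
exists (c4 * Num.sqrt 2), c4 => tau tau0.
pose k := (Num.truncn tau).+2.
have /andP[tk1 tk2] : tau + 1 <= k%:R <= tau + 2.
  have /andP[t1 t2] := truncn_itv (ltW tau0).
  by rewrite /k -[_.+2]addn1 -[_.+1]addn1 !natrD in t2 *; lra.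
pose a := alpha ^+ 2 * b.
(* [m >= N] means [r (1 + 2 a gamma) <= 1], which gives both [r <= 1] and the smallness
   [a gamma r <= 1/2] needed to invert [I + N], where this last [N] is the operator. *)
pose N : R := D * k%:R * (1 + 2 * (a * gamma)) ^+ 2.
exists (maxn k (Num.truncn N).+1).
move=> d Omega P x eps K iota epsK x2 xmu xS leps _ _ ci ii _ _ epsKP xsg.
move=> [W0 [lW cW WE]] m; rewrite geq_max => /andP[km Nm].
move=> d' Omega' Q xs Bstar Bhat iid Bs Bh.
have [W WW0] := linear_pack lW; rewrite -WW0 in cW WE.
have m0 : (0 < m)%N by exact: leq_trans km.
have mR : 0 < m%:R :> R by rewrite ltr0n.
have D0 : 0 <= D.
  apply: mulr_ge0; first by rewrite mulr_ge0// expR_ge0.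
  by rewrite mulr_ge0// sqr_ge0.
have gamma0 : 0 <= gamma by rewrite addr_ge0// mulr_ge0.
have a0 : 0 <= a by rewrite mulr_ge0 ?(ltW b0)// sqr_ge0.
have ag0 : 0 <= a * gamma by rewrite mulr_ge0.
have Sx_sym := covariance_sym xS.
have Sx_ge0 := covariance_ge0 xS.
have Sx_le := covariance_bound parseval x2 xS.
have sigma0 : 0 <= sigma := covariance_trace_ge0 e xS.
have Se_coercive : forall u, `|u| ^+ 2 <= b * inner (Se u) u.
  apply: coercive_of_inverse ST T_le => //.
  - exact: process_covariance_sym leps.
  - exact: process_covariance_ge0 leps.
have Zint := integral_sqnorm_noise parseval leps cA ci b0 Se_coercive Sx_sym
  Sx_ge0 epsKP cW WE.
have zeta0 : 0 <= zeta.
  rewrite -lee_fin -Zint; apply: integral_ge0 => w _.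
  by rewrite lee_fin exprn_ge0.
have [E [mE QE Edev]] := feature_deviation_event parseval x2 xmu xS xsg iid
  (isT : (0 < k)%N) km.
exists E; split => //.
  apply: lt_le_trans QE; rewrite lte_fin ltrD2l ltrN2.
  exact: expRN_tail.
move=> w Ew.
pose r := Num.sqrt (D * k%:R / m%:R).
have r0 : 0 <= r := sqrtr_ge0 _.
have r2 : r ^+ 2 = D * k%:R / m%:R.
  by rewrite sqr_sqrtr// divr_ge0// mulr_ge0.
have r_le : r * (1 + 2 * (a * gamma)) <= 1.
  have f0 : 0 <= 1 + 2 * (a * gamma) by rewrite addr_ge0// mulr_ge0.
  rewrite -(@ler_pXn2r _ 2)// ?nnegrE ?(mulr_ge0 r0 f0)//.
  rewrite exprMn r2 expr1n mulrAC ler_pdivrMr// mul1r.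
  apply: le_trans (ltW (truncnS_gt _)) _.
  by rewrite ler_nat.
have r1 : r <= 1.
  have : 0 <= r * (2 * (a * gamma)) by apply: mulr_ge0 => //; exact: mulr_ge0.
  by move: r_le; rewrite mulrDr mulr1; lra.
have ar : alpha ^+ 2 * b * gamma * r <= 2^-1.
  by move: r_le; rewrite -/a mulrDr mulr1; lra.
have dev n : \sum_(p : 'I_n * 'I_n) (\sum_i (feature e p.1 (xs i w) *
    feature e p.2 (xs i w) - feature_mean e mu Sx p.1 p.2)) ^+ 2 <=
    (m%:R * r) ^+ 2.
  apply: le_trans (Edev w Ew n) _; rewrite exprMn r2 /D le_eqVlt.
  by apply/orP; left; apply/eqP; field; rewrite gt_eqF.
have hmu := sample_mean_deviation parseval m0 r0 dev.
have Dle v : `|Bhat w (Bhat w v) - Sx v| <= gamma * r * `|v|.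
  have [_ ->] := Bh w.
  apply: le_trans (sample_covariance_deviation parseval m0 r0 Sx_sym dev v) _.
  rewrite ler_wpM2r// /gamma.
  have : r * r <= r by rewrite ler_piMr.
  lra.
have [Bhp _] := Bh w.
have pert om := reconstruction_perturbation cA ci ii b0 cSe Se_coercive
  (ltW alpha0) sigma0 gamma0 A_le Sx_le cW WE Bs Bhp r0 r1 ar hmu Dle (x om) (epsK om).
rewrite /expected_error unlock.
have rx : random_vector x by case: x2.
have rK : random_vector epsK by case: epsKP => -[].
have mx : measurable_fun setT (fun om => (`|x om - mu| ^+ 2)%:E).
  by have /integrableP[] := integrable_sqnorm_centered parseval mu x2.
have mZ : measurable_fun setT (fun om => (`|W (epsK om)| ^+ 2)%:E).
  apply/measurable_EFinP; apply: (measurable_sqnorm parseval).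
  exact: (measurable_inner_noise epsKP cW).
have ec0 : 0 <= ec by rewrite mulr_ge0 ?sqr_ge0.
have mG : measurable_fun setT
    (fun om => 1 + `|x om - mu| ^+ 2 + `|W (epsK om)| ^+ 2).
  apply: measurable_funD; last exact/measurable_EFinP.
  by apply: measurable_funD => //; exact/measurable_EFinP.
apply: (@le_trans _ _ (r * ec * (1 + sigma + zeta))%:E).
  apply: (@integral_dist_le _ _ _ P _ _
    (fun om => 1 + `|x om - mu| ^+ 2 + `|W (epsK om)| ^+ 2) _ ec).
  - exact: measurable_error parseval cA ci rx rK.
  - exact: measurable_error parseval cA ci rx rK.
  - exact: mG.
  - by rewrite mulr_ge0.
  - by move=> om; rewrite !addr_ge0// exprn_ge0.
  - under eq_integral do rewrite EFinD EFinD.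
    rewrite ge0_integralD//; last 2 first.
    + by move=> om _; rewrite adde_ge0// lee_fin exprn_ge0.
    + exact: emeasurable_funD.
    rewrite ge0_integralD// Zint (integral_sqnorm_centered parseval x2 xS).
    by rewrite (integral_probability_cst P 1%E).
  - by move=> om; have [h _] := pert om.
  - move=> om; have [_ h] := pert om.
    by rewrite ger0_norm// exprn_ge0.
rewrite lee_fin.
have rE : r = Num.sqrt D * Num.sqrt k%:R / Num.sqrt m%:R.
  have Dk0 : 0 <= D * k%:R by apply: mulr_ge0.
  by rewrite /r (sqrtrM _ Dk0) (sqrtrM _ D0) sqrtrV.
have kS : Num.sqrt k%:R <= Num.sqrt 2 + Num.sqrt tau.
  apply: le_trans (sqrtr_addr_le _ (ltW tau0)) => //.
  by rewrite ler_wsqrtr// addrC.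
have -> : r * ec * (1 + sigma + zeta) = c4 * Num.sqrt k%:R / Num.sqrt m%:R.
  by rewrite rE /c4; ring.
rewrite ler_wpM2r ?invr_ge0 ?sqrtr_ge0// -mulrDr ler_wpM2l//.
by rewrite mulr_ge0 ?sqrtr_ge0// mulr_ge0// !addr_ge0.
Qed.
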